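(* Let $X$ be a (complete) doubling metric measure space, let $1\le p<\infty$ and $\beta\ne p$, and assume that the open set $\Omega\subset X$ admits a $(p,\beta)$-Hardy inequality. Then there exists $\varepsilon>0$, depending only on $p$, $\beta$, the doubling constant of $\mu$ and the constant of the Hardy inequality, such that either \[\operatorname{co\,dim}_H(X\setminus\Omega)<p-\beta-\varepsilon\quad\text{or}\quad\underline{\operatorname{co\,dim}}_A(X\setminus\Omega)>p-\beta+\varepsilon.\]
   Context: $(X,d,\mu)$ is a complete metric space with a Borel measure $\mu$ such that every closed ball $B(x,r)=\{y:d(x,y)\le r\}$, $r>0$, has $0<\mu(B(x,r))<\infty$, and $\mu$ is doubling. A Borel function $g\ge 0$ is an upper gradient of $f$ if $|f(x)-f(y)|\le\int_\gamma g\,ds$ for every compact rectifiable curve $\gamma$ with endpoints $x,y$. For open $\Omega\subset X$, $d_\Omega(x)=\operatorname{dist}(x,X\setminus\Omega)$; $\Omega$ admits a $(p,\beta)$-Hardy inequality if there is $C>0$ with $\int_\Omega|u|^p d_\Omega^{\beta-p}\,d\mu\le C\int_\Omega g_u^p d_\Omega^{\beta}\,d\mu$ for all Lipschitz $u$ with compact support in $\Omega$ and all upper gradients $g_u$ of $u$. For $E\subset X$: $E_r=\{x:\operatorname{dist}(x,E)<r\}$; $\underline{\operatorname{co\,dim}}_A(E)$ is the supremum of all $t\ge0$ for which there is $C\ge1$ with $\frac{\mu(E_r\cap B(x,R))}{\mu(B(x,R))}\le C(r/R)^t$ for all $x\in E$, $0<r<R<\operatorname{diam}(E)$. The Hausdorff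 content of codimension $q$ is $\mathcal H_R^{\mu,q}(A)=\inf\{\sum_k\operatorname{rad}(B_k)^{-q}\mu(B_k): A\subset\bigcup_k B_k,\ \operatorname{rad}(B_k)\le R\}$, and the Hausdorff codimension is $\operatorname{co\,dim}_H(E)=\sup\{q\ge0:\mathcal H_R^{\mu,q}(E)=0\}$ (independent of $R>0$), with $\operatorname{co\,dim}_H(E)=0$ if $\mu(E)>0$. *)

(* Defs.v *)
From HB Require Import structures.
From mathcomp Require Import all_boot all_order all_algebra.
From mathcomp Require Import all_classical all_reals all_analysis.
Set Implicit Arguments. Unset Strict Implicit. Unset Printing Implicit Defensive.
Import Order.TTheory GRing.Theory Num.Theory.
Local Open Scope classical_set_scope.
Local Open Scope ring_scope.

Section MetricDefs.
Context {R : realType} {X : Type}.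
Variable (d : X -> X -> R).

Definition is_metric : Prop :=
  [/\ forall x y, 0 <= d x y,
      forall x y, d x y = 0 <-> x = y,
      forall x y, d x y = d y x &
      forall x y z, d x z <= d x y + d y z].

Definition metric_complete : Prop :=
  forall u : nat -> X,
    (forall e : R, 0 < e -> exists N, forall m n, (N <= m)%N -> (N <= n)%N -> d (u m) (u n) < e) ->
    exists l, forall e : R, 0 < e -> exists N, forall n, (N <= n)%N -> d (u n) l < e.

Definition cball (x : X) (r : R) : set X := [set y | d x y <= r].
Definition oball (x : X) (r : R) : set X := [set y | d x y < r].

Definition mopen (A : set X) : Prop :=
  forall x, A x -> exists r : R, 0 < r /\ oball x r `<=` A.

Definition mclosure (A : set X) : set X :=
  [set x | forall r : R, 0 < r -> oball x r `&` A !=set0].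

Definition mcompact (K : set X) : Prop :=
  forall (I : Type) (F : I -> set X), (forall i, mopen (F i)) ->
    K `<=` \bigcup_i F i ->
    exists J : set I, finite_set J /\ K `<=` \bigcup_(i in J) F i.

Definition lipschitz (u : X -> R) : Prop :=
  exists L : R, forall x y, `|u x - u y| <= L * d x y.

Definition support (u : X -> R) : set X := mclosure [set x | u x != 0].

(* dist(x, A) as an extended real (+oo if A is empty) *)
Definition edist (x : X) (A : set X) : \bar R :=
  ereal_inf [set (d x y)%:E | y in A].

Definition dOm (Om : set X) (x : X) : R := fine (edist x (~` Om)).

Definition nbhd_set (E : set X) (r : R) : set X := [set x | edist x E < r%:E]%E.

Definition ediam (E : set X) : \bar R :=
  ereal_sup [set (d x y)%:E | x in E & y in E].

Definition curve_length (gamma : R -> X) (a b : R) : \bar R :=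
  ereal_sup [set v : \bar R | exists (n : nat) (s : nat -> R),
     [/\ s 0%N = a, s n = b, (forall i, (i < n)%N -> s i <= s i.+1) &
        v = (\sum_(i < n) d (gamma (s i)) (gamma (s i.+1)))%:E]].

(* gamma : [0,L] -> X is an arc-length parametrized (hence rectifiable,
   compact) curve *)
Definition arclength_curve (gamma : R -> X) (L : R) : Prop :=
  0 <= L /\ forall s t, 0 <= s -> s <= t -> t <= L ->
    curve_length gamma s t = (t - s)%:E.

End MetricDefs.

Section MeasureDefs.
Context {R : realType} {disp : measure_display} {X : measurableType disp}.
Variables (d : X -> X -> R) (mu : {measure set X -> \bar R}).

Definition borel_wrt_metric : Prop :=
  (@measurable _ X) = <<s [set A | mopen d A] >>.

Definition balls_pos_finite : Prop :=
  forall x r, 0 < r -> (0 < mu (cball d x r))%E /\ (mu (cball d x r) < +oo)%E.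

Definition doubling_with (Cd : R) : Prop :=
  forall x r, 0 < r -> (mu (cball d x (2 * r)) <= Cd%:E * mu (cball d x r))%E.

Definition line_integral (g : X -> R) (gamma : R -> X) (L : R) : \bar R :=
  (\int[lebesgue_measure]_(t in [set t : R | (0 <= t <= L)%R]) (g (gamma t))%:E)%E.

Definition upper_gradient (f g : X -> R) : Prop :=
  measurable_fun setT g /\ (forall x, 0 <= g x) /\
  forall (gamma : R -> X) (L : R), arclength_curve d gamma L ->
    (`|f (gamma 0) - f (gamma L)|%:E <= line_integral g gamma L)%E.

Definition hardy_with (Om : set X) (p beta C : R) : Prop :=
  0 < C /\
  forall u : X -> R, lipschitz d u -> mcompact d (support d u) -> support d u `<=` Om ->
  forall g : X -> R, upper_gradient u g ->
    (\int[mu]_(x in Om) ((`|u x| `^ p) * (dOm d Om x `^ (beta - p)))%:E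
     <= C%:E * \int[mu]_(x in Om) ((g x `^ p) * (dOm d Om x `^ beta))%:E)%E.

Definition lower_assouad_codim (E : set X) : \bar R :=
  ereal_sup [set t%:E | t in [set t : R | 0 <= t /\
    exists C : R, 1 <= C /\
      forall x r Rr, E x -> 0 < r -> r < Rr -> (Rr%:E < ediam d E)%E ->
        (mu (nbhd_set d E r `&` cball d x Rr)
          <= (C * (r / Rr) `^ t)%:E * mu (cball d x Rr))%E]].

Definition hcontent (q Rr : R) (A : set X) : \bar R :=
  ereal_inf [set v : \bar R | exists (c : nat -> X) (r : nat -> R),
     [/\ forall k, 0 < r k /\ r k <= Rr,
        A `<=` \bigcup_k cball d (c k) (r k) &
        v = (\sum_(0 <= k <oo) ((r k `^ (- q))%:E * mu (cball d (c k) (r k))))%E]].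

(* Hausdorff codimension (scale R = 1; independent of the scale) *)
Definition hausdorff_codim (E : set X) : \bar R :=
  if `[< (0 < mu E)%E >] then 0%E
  else ereal_sup [set q%:E | q in [set q : R | 0 <= q /\ hcontent q 1 E = 0%E]].

End MeasureDefs.

(* Main.v *)
(* Fix x0 in E = X \ Om, write q = p - beta > 0 and d = d_Om. The Hardy
   inequality is tested with u = w^(n+1) psi(d), where psi is a two-sided power
   with peak at a scale rho and small logarithmic slope b, and w cuts off a ball
   B(x0, 2R) from outside and small neighbourhoods of E inside it. Both gradient
   terms can be absorbed: b u / d because b is small, and w^n psi / s, with s the
   scale of the cutoff, wherever d <= theta w s; where d > theta w s it is bounded
   by a constant on a ball of radius comparable to s. If co dim_H E > q - bp, the
   content of codimension q - bp of E vanishes, so the balls near E can be chosen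
   with negligible total contribution for fixed rho. What is left is
     mu (B(x0, R) inter {rho < d <= r}) <= C (r / R)^(q + bp) mu (B(x0, R))
   with C independent of rho; letting rho tend to 0 gives co dim_A E >= q + bp. *)
Require Import Defs.
From HB Require Import structures.
From mathcomp Require Import all_boot all_order all_algebra.
From mathcomp Require Import all_classical all_reals all_analysis.
From mathcomp Require Import measurable_realfun ring lra.
Set Implicit Arguments. Unset Strict Implicit. Unset Printing Implicit Defensive.
Import Order.TTheory GRing.Theory Num.Theory.
Import numFieldNormedType.Exports.
Local Open Scope classical_set_scope.
Local Open Scope ring_scope.

(** * Metric balls and compactness *)

(** The two slopes of [psi] do different jobs. Near E, psi^p <= rho^(-bp) d^(bp) lowers the exponent
    with which a cover ball counts from q to q - bp; far from E, psi^p <= rho^(bp) d^(-bp) raises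
    the exponent of the outer ball from q to q + bp. Dividing by rho^(bp) frees the outer term of
    rho and leaves a factor rho^(-2bp) on the cover term, harmless because rho is fixed before the
    cover is chosen. The obstacle is the weight d^(beta + bp) or d^(beta - bp) met by the gradient
    of the cutoff: its exponent may be negative, so it can blow up where d is far below s. There
    either the term is absorbed, or d > theta w s and the spare power w^n pays for the blow-up.
    Absorption subtracts the left side of the Hardy inequality from both sides, so that side must be
    finite. Hence the support is kept compact in Om (completeness and doubling make closed bounded
    sets compact), while the resulting bound does not see its distance to E. The slope b is dictated
    by (2b)^p C_H <= 1/4 and bp <= p - beta; taking epsilon = bp/2 leaves room for strictness in
    both alternatives. *)

Section Metric.
Context {R : realType} {X : Type} (d : X -> X -> R).
Hypothesis dm : is_metric d.

Lemma dist_ge0 x y : 0 <= d x y. Proof. by case: dm. Qed.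

Lemma distxx x : d x x = 0. Proof. by case: dm => _ /(_ x x) [_ ->]. Qed.

Lemma dist_sym x y : d x y = d y x. Proof. by case: dm. Qed.

Lemma dist_tri z x y : d x y <= d x z + d z y. Proof. by case: dm. Qed.

Lemma mopenC_cball x r : mopen d (~` cball d x r).
Proof.
move=> y /= /negP; rewrite -ltNge => xy; exists (d x y - r).
rewrite subr_gt0; split=> // z; rewrite /oball /cball /= => yz xz.
have := dist_tri z x y; rewrite (dist_sym z y); lra.
Qed.

Lemma mopen_oball x r : mopen d (oball d x r).
Proof.
move=> y; rewrite /oball /= => xy; exists (r - d x y).
by rewrite subr_gt0; split=> // z /=; have := dist_tri y x z; lra.
Qed.

Lemma mopenC_mclosure (A : set X) : mopen d (~` mclosure d A).
Proof.
move=> x /= /existsNP[r /not_implyP[r0 rA]]; exists r; split=> // y xy yA.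
case: (mopen_oball xy) => s [s0 sr]; case: (yA s s0) => z [yz Az].
by apply: rA; exists z; split=> //; exact: sr.
Qed.

Lemma mclosure_sub (A K : set X) :
  mopen d (~` K) -> A `<=` K -> mclosure d A `<=` K.
Proof.
move=> oK AK x xA; apply: contrapT => /oK[r [r0 rK]].
by case: (xA r r0) => y [/rK yK /AK].
Qed.

(* The metric is not registered as a topology on [X]; limits at a point are
   taken along this filter instead. *)
Definition near_pt (x : X) : set_system X :=
  filter_from [set r : R | 0 < r] (oball d x).

Global Instance near_pt_filter x : Filter (near_pt x).
Proof.
apply: filter_from_filter; first by exists 1; rewrite /= ltr01.
move=> r s /= r0 s0; exists (Num.min r s); first by rewrite /= lt_min r0.
by move=> y; rewrite /oball /= lt_min => /andP[].
Qed.

Lemma near_ptP x (A : set X) :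
  near_pt x A <-> exists r, 0 < r /\ oball d x r `<=` A.
Proof. by split=> [[r ? ?]|[r [? ?]]]; exists r. Qed.

Lemma near_pt_cvg (f : X -> R) (L : R) x :
  (forall y, `|f x - f y| <= L * d x y) -> f @ near_pt x --> f x.
Proof.
move=> fL; apply/cvgrPdist_lt => e e0.
have L1 : 0 < `|L| + 1 by rewrite ltr_pwDr.
exists (e / (`|L| + 1)); first by rewrite /= divr_gt0.
move=> y; rewrite /oball /= ltr_pdivlMr// => xy.
apply: le_lt_trans xy; apply: le_trans (fL y) _; rewrite mulrC.
by rewrite ler_wpM2l ?dist_ge0//; have := ler_norm L; lra.
Qed.

Definition totally_bounded :=
  forall x (r e : R), 0 < e ->
    exists n (c : nat -> X), cball d x r `<=` \bigcup_(i < n) cball d (c i) e.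

(** If no finite subfamily covers K, the same holds for some piece of K in a small ball. Repeating
    this with radii 1/(n+1) gives nested pieces whose points form a Cauchy sequence; one member of
    the cover contains a neighbourhood of the limit, hence a whole piece. *)
Lemma mcompact_closed (K : set X) x0 r0 :
  metric_complete d -> totally_bounded -> mopen d (~` K) ->
  K `<=` cball d x0 r0 -> mcompact d K.
Proof.
move=> dc tb oK Kb I F oF KF; apply: contrapT => nJ.
pose P (A : set X) := forall J, finite_set J -> ~ (A `<=` \bigcup_(i in J) F i).
have PK : P K by move=> J fJ KJ; apply: nJ; exists J.
have step (A : set X) e : 0 < e -> A `<=` K -> P A ->
    exists c, P (A `&` cball d c e).
  move=> e0 AK PA; apply: contrapT => /forallNP nc.
  have /choice[J HJ] : forall c, exists J, finite_set J /\
      A `&` cball d c e `<=` \bigcup_(i in J) F i.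
    move=> c; have /existsNP[J /not_implyP[fJ /contrapT AJ]] := nc c.
    by exists J.
  have [n [c cn]] := tb x0 r0 e e0.
  apply: (PA (\bigcup_(i < n) J (c i))).
    by apply: bigcup_finite => // i _; case: (HJ (c i)).
  move=> x Ax; have [i /= ni xi] := cn x (Kb _ (AK _ Ax)).
  have [j Jj Fj] := (HJ (c i)).2 x (conj Ax xi).
  by exists j => //; exists i.
(* A centre is chosen for every set and stage, with the junk value [x0] when the set is finitely
   covered, so that [A] below is a plain recursion. *)
have [f Hf] : exists f : set X -> nat -> X, forall A n, A `<=` K -> P A ->
    P (A `&` cball d (f A n) n.+1%:R^-1).
  have /choice[f Hf] : forall An : set X * nat, exists c, An.1 `<=` K -> P An.1 ->
      P (An.1 `&` cball d c An.2.+1%:R^-1).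
    move=> [A n] /=; case: (pselect (A `<=` K /\ P A)) => [[AK PA]|h].
      by have [c Hc] := step A n.+1%:R^-1 ltac:(by rewrite invr_gt0) AK PA; exists c.
    by exists x0 => AK PA; case: h.
  by exists (fun A n => f (A, n)) => A n; exact: (Hf (A, n)).
pose A := fix A n := if n is m.+1 then A m `&` cball d (f (A m) m) m.+1%:R^-1 else K.
have HA n : A n `<=` K /\ P (A n).
  by elim: n => [|n [AK PA]]; [split | split; [move=> x [/AK] | exact: Hf]].
have Amono m n : (m <= n)%N -> A n `<=` A m.
  elim: n => [|n IH]; first by rewrite leqn0 => /eqP ->.
  by rewrite leq_eqVlt => /predU1P[->//|/IH h] x [/h].
have /choice[u Hu] n : exists x, A n x.
  apply: contrapT => /forallNP nA; apply: ((HA n).2 set0) => // x /nA [].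
have Adiam k n : (k.+1 <= n)%N -> A n `<=` cball d (f (A k) k) k.+1%:R^-1.
  by move=> kn x /(Amono _ _ kn)[].
have small (e : R) : 0 < e -> exists k, k.+1%:R^-1 < e :> R.
  by move=> /ltr_add_invr[k]; rewrite add0r; exists k.
have [l Hl] : exists l, forall e : R, 0 < e ->
    exists N, forall n, (N <= n)%N -> d (u n) l < e.
  apply: dc => e e0; have [k ke] := small (e / 2) ltac:(lra).
  exists k.+1 => m n km kn.
  have := Adiam _ _ km _ (Hu m); have := Adiam _ _ kn _ (Hu n).
  rewrite /cball /=; have := dist_tri (f (A k) k) (u m) (u n).
  rewrite (dist_sym (u m) (f _ _)); move: ke; set v := _^-1; lra.
have Kl : K l.
  apply: contrapT => /oK[r [r1 rK]]; have [N HN] := Hl r r1.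
  apply: (rK (u N)); last exact: (HA N).1.
  by rewrite /oball /= dist_sym; exact: HN.
have [i _ Fil] := KF l Kl; have [r [r1 rF]] := oF i l Fil.
have [k kr] := small (r / 4) ltac:(lra).
have [N HN] := Hl (r / 4) ltac:(lra).
pose n := maxn N k.+1.
apply: ((HA n).2 [set i] (finite_set1 i)) => x Anx.
exists i => //; apply: rF; rewrite /oball /=.
have := Adiam k n (leq_maxr _ _) _ Anx.
have := Adiam k n (leq_maxr _ _) _ (Hu n).
have := HN n (leq_maxl _ _); rewrite /cball /=.
have := dist_tri (u n) l x; have := dist_tri (f (A k) k) (u n) x.
rewrite (dist_sym l (u n)) (dist_sym (u n) (f _ _)); move: kr; set v := _^-1; lra.
Qed.

(** * Distance to the complement of an open set *)

Section BoundaryDistance.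
Variable Om : set X.
Hypothesis oOm : mopen d Om.
Variable e0 : X.
Hypothesis Ee0 : ~ Om e0.

(** The point [e0] outside [Om] makes the infimum finite; for an empty complement [fine] would send
    +oo to 0. *)
Lemma edistE x : Defs.edist d x (~` Om) = (dOm d Om x)%:E.
Proof.
rewrite /dOm fineK// ge0_fin_numE.
  apply: le_lt_trans (ltry (d x e0)).
  by apply: ereal_inf_lbound; exists e0.
by apply: le_ereal_inf_tmp => _ [y _ <-]; rewrite lee_fin dist_ge0.
Qed.

Lemma dOm_le x y : ~ Om y -> dOm d Om x <= d x y.
Proof. by move=> Ey; rewrite -lee_fin -edistE; apply: ereal_inf_lbound; exists y. Qed.

Lemma dOm_ge x r : (forall y, ~ Om y -> r <= d x y) -> r <= dOm d Om x.
Proof.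
move=> H; rewrite -lee_fin -edistE; apply: le_ereal_inf_tmp => _ [y /H h <-].
by rewrite lee_fin.
Qed.

Lemma dOm_lip x y : `|dOm d Om x - dOm d Om y| <= d x y.
Proof.
have H z w : dOm d Om z - d z w <= dOm d Om w.
  apply: dOm_ge => v Ev; have := dOm_le z Ev; have := dist_tri w z v; lra.
by rewrite ler_norml; have := H x y; have := H y x; rewrite (dist_sym y); lra.
Qed.

Lemma dOm_gt0 x : Om x -> 0 < dOm d Om x.
Proof.
move=> /oOm[r [r0 rO]]; apply: lt_le_trans r0 _; apply: dOm_ge => y Ey.
by rewrite leNgt; apply/negP => xy; apply: Ey; exact: rO.
Qed.

Lemma dOm_gt0P x : 0 < dOm d Om x <-> Om x.
Proof.
split=> [x0|]; last exact: dOm_gt0.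
by apply: contrapT => /dOm_le - /(_ x); rewrite distxx leNgt x0.
Qed.

End BoundaryDistance.

(** The superlevel sets of the distance at 1/(n+1) are open, increase with n and cover K; the
    largest index of a finite subcover gives [dl]. *)
Lemma dOm_compact_gt0 (Om K : set X) e0 : mopen d Om -> ~ Om e0 ->
  mcompact d K -> K `<=` Om ->
  exists dl : R, 0 < dl /\ forall x, K x -> dl <= dOm d Om x.
Proof.
move=> oOm Ee0 cK KO.
pose F n := [set x | n.+1%:R^-1 < dOm d Om x].
have [n x /= h|x Kx|J [fJ KJ]] := cK nat F.
- move: h; rewrite /F /=; set v := _^-1 => h; exists (dOm d Om x - v); rewrite subr_gt0; split=> // y.
  rewrite /oball /F /= -/v => xy; have := dOm_lip Ee0 x y.
  by rewrite ler_norml => /andP[]; lra.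
- have /ltr_add_invr[n] := dOm_gt0 oOm Ee0 (KO _ Kx).
  by rewrite add0r => h; exists n.
have [s Js] : exists s : seq nat, J = [set` s] by apply/finite_seqP.
exists (\max_(i <- s) i).+1%:R^-1; rewrite invr_gt0 ltr0n; split => // x /KJ[i].
rewrite Js /F /= => si /ltW; apply: le_trans; rewrite lef_pV2 ?posrE ?ltr0n//.
by rewrite ler_nat ltnS; exact: leq_bigmax_seq.
Qed.

End Metric.

(** * Doubling measures *)

Section MetricMeasure.
Context {R : realType} {disp : measure_display} {X : measurableType disp}.
Variables (d : X -> X -> R) (mu : {measure set X -> \bar R}).
Hypothesis dm : is_metric d.
Hypothesis dB : borel_wrt_metric d.

Lemma measurable_mopen (A : set X) : mopen d A -> measurable A.
Proof. by rewrite dB => oA; exact: sub_sigma_algebra. Qed.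

Lemma measurable_mclosed (A : set X) : mopen d (~` A) -> measurable A.
Proof. by move=> oA; rewrite -(setCK A); apply/measurableC/measurable_mopen. Qed.

Lemma measurable_cball x r : measurable (cball d x r).
Proof. exact/measurable_mclosed/mopenC_cball. Qed.

Lemma measurable_lsc (f : X -> R) :
  (forall x e, 0 < e -> near_pt d x [set y | f x - e < f y]) ->
  measurable_fun setT f.
Proof.
move=> lsc; apply: (measurability _ (RGenOInfty.measurableE R)).
move=> /= _ [_ [a ->]] <-; apply: measurableI => //; apply: measurable_mopen.
move=> x /=; rewrite in_itv /= andbT => ax.
have fa : 0 < f x - a by rewrite subr_gt0.
have /near_ptP[r [r0 rf]] := lsc x _ fa.
exists r; split=> // y /rf /=; rewrite in_itv /= andbT; lra.
Qed.

Lemma measurable_lip (f : X -> R) (L : R) :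
  (forall x y, `|f x - f y| <= L * d x y) -> measurable_fun setT f.
Proof.
move=> fL; apply: measurable_lsc => x e e0.
have /cvgrPdist_lt/(_ e e0) := near_pt_cvg dm (fL x).
by apply: filterS => y /=; rewrite ltr_norml => /andP[]; lra.
Qed.

Hypothesis mu_ball : balls_pos_finite d mu.

Lemma le_cball x y r s : d x y + r <= s -> (mu (cball d y r) <= mu (cball d x s))%E.
Proof.
move=> rs; apply: le_measure; rewrite ?inE; try exact: measurable_cball.
by move=> z; rewrite /cball /=; have := dist_tri dm y x z; lra.
Qed.

Lemma mu_cball_fin x r : mu (cball d x r) \is a fin_num.
Proof.
rewrite ge0_fin_numE//; apply: (@le_lt_trans _ _ (mu (cball d x (`|r| + 1)))).
  by apply: le_cball; rewrite distxx//; have := ler_norm r; lra.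
by have [] := mu_ball x (ltr_pwDr ltr01 (normr_ge0 r)).
Qed.

Definition vol x r := fine (mu (cball d x r)).

Lemma volE x r : mu (cball d x r) = (vol x r)%:E.
Proof. by rewrite /vol fineK// mu_cball_fin. Qed.

Lemma vol_gt0 x r : 0 < r -> 0 < vol x r.
Proof. by move=> /(mu_ball x)[]; rewrite volE lte_fin. Qed.

Lemma vol_le x y r s : d x y + r <= s -> vol y r <= vol x s.
Proof. by move=> rs; rewrite -lee_fin -!volE le_cball. Qed.

Variable Cd : R.
Hypothesis dbl : doubling_with d mu Cd.

Lemma vol_double x r : 0 < r -> vol x (2 * r) <= Cd * vol x r.
Proof. by move=> /(dbl x); rewrite !volE -EFinM lee_fin. Qed.

Lemma doubling_ge1 : 1 <= Cd.
Proof.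
have x : X := point; have v1 := vol_gt0 x (@ltr01 R).
rewrite -(ler_pM2r v1) mul1r; apply: le_trans (vol_double x ltr01).
by apply: vol_le; rewrite distxx//; lra.
Qed.

Lemma vol_double_iter x r k : 0 < r -> vol x (2 ^+ k * r) <= Cd ^+ k * vol x r.
Proof.
move=> r0; elim: k => [|k IH]; first by rewrite !expr0 !mul1r.
rewrite !exprS -!mulrA; apply: le_trans (vol_double x _) _.
  by rewrite mulr_gt0// exprn_gt0.
by rewrite ler_wpM2l//; have := doubling_ge1; lra.
Qed.

(** B(x, s) lies in B(y, 2s), and the number of doublings from r to 2s depends on r and s only, so
    one constant serves all centres. *)
Lemma vol_comparable (r s : R) : 0 < r ->
  exists C, 0 < C /\ forall x y, d x y <= s -> vol x s <= C * vol y r.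
Proof.
move=> r0; have [k ks] : exists k : nat, 2 * s <= 2 ^+ k * r.
  have [k ks] : exists k : nat, 2 * s / r <= k%:R.
    exists (Num.truncn (2 * s / r)).+1; exact/ltW/truncnS_gt.
  exists k; rewrite -ler_pdivrMr//; apply: le_trans ks _.
  by rewrite -natrX ler_nat ltnW// ltn_expl.
exists (Cd ^+ k); split; first by rewrite exprn_gt0// (lt_le_trans ltr01 doubling_ge1).
move=> x y xy; apply: le_trans (vol_double_iter y k r0); apply: vol_le.
by move: ks; set q := _ ^+ k * r; rewrite (dist_sym dm y x); lra.
Qed.

(** The balls B(c_i, e/3) are disjoint, lie in B(x, |r| + e), and each carries a fixed fraction of
    its measure. *)
Lemma separated_bounded x (r e : R) : 0 < e ->
  exists C : R, forall n (c : nat -> X),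
    (forall i, (i < n)%N -> cball d x r (c i)) ->
    (forall i j, (i < j < n)%N -> e < d (c i) (c j)) -> n%:R <= C.
Proof.
move=> e0; have e3 : 0 < e / 3 by lra.
have [C [C0 HC]] := vol_comparable (`|r| + e) e3.
exists C => n c cr ce; have rr := ler_norm r; set v := vol x (`|r| + e).
have v0 : 0 < v by apply: vol_gt0; rewrite ltr_wpDl.
rewrite -(ler_pM2r v0).
pose F i := cball d (c i) (e / 3).
have mF i : measurable (F i) by exact: measurable_cball.
have mU : measurable (\big[setU/set0]_(i < n) F i) by exact: bigsetU_measurable.
have tF : trivIset `I_n F.
  move=> i j /= ni nj [z []]; rewrite /F /cball /=.
  have H k l : (k < l < n)%N -> d (c k) z <= e / 3 -> d (c l) z <= e / 3 -> False.
    move=> /ce; have := dist_tri dm z (c k) (c l).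
    by rewrite (dist_sym dm z); lra.
  case: (ltngtP i j) => // ij zi zj.
    by case: (H i j); rewrite // ij.
  by case: (H j i); rewrite // ij.
have : (mu (\big[setU/set0]_(i < n) F i) <= v%:E)%E.
  rewrite -volE; apply: le_measure; rewrite ?inE//; first exact: measurable_cball.
  rewrite -bigcup_mkord => z [i /= ni]; rewrite /F /cball /=.
  by have := cr i ni; have := dist_tri dm (c i) x z; rewrite /cball /=; lra.
rewrite measure_semi_additive_ord_I//.
rewrite (eq_bigr (fun i : 'I_n => (vol (c i) (e / 3))%:E)); last by move=> i _; rewrite -volE.
rewrite sumEFin lee_fin => Sv.
apply: le_trans (ler_wpM2l (ltW C0) Sv).
rewrite mulr_sumr -[n in n%:R]card_ord mulr_natl -sumr_const.
apply: ler_sum => i _; apply: HC.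
by have := cr i (ltn_ord i); rewrite /cball /=; lra.
Qed.

(** Without a finite e-net, separated families could be extended greedily to any length, against
    [separated_bounded]. *)
Lemma doubling_totally_bounded : totally_bounded d.
Proof.
move=> x r e e0; apply: contrapT => /forallNP nc.
have H n : exists c : nat -> X, (forall i, (i < n)%N -> cball d x r (c i)) /\
    (forall i j, (i < j < n)%N -> e < d (c i) (c j)).
  elim: n => [|n [c [cr ce]]].
    by exists (fun=> x); split=> // i j; rewrite ltn0 andbF.
  have [y [yr yc]] : exists y, cball d x r y /\ forall i, (i < n)%N -> e < d (c i) y.
    apply: contrapT => /forallNP ny; apply: (nc n); exists c => y yr.
    apply: contrapT => yU; apply: (ny y); split=> // i ni.
    by rewrite ltNge; apply/negP => ?; apply: yU; exists i.
  exists (fun i => if (i < n)%N then c i else y); split=> [i|i j].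
    by case: ifP => // + _; exact: cr.
  rewrite ltnS => /andP[ij]; rewrite leq_eqVlt => /predU1P[jn|jn].
    by move: ij; rewrite jn ltnn => ij; rewrite ij; exact: yc.
  by rewrite jn (ltn_trans ij)//; apply: ce; rewrite ij.
have [C HC] := separated_bounded x r e0.
have [c [cr ce]] := H (Num.truncn C).+1.
by have := HC _ _ cr ce; rewrite leNgt truncnS_gt.
Qed.

Lemma mcompact_cball (dc : metric_complete d) (K : set X) x r :
  mopen d (~` K) -> K `<=` cball d x r -> mcompact d K.
Proof. exact: mcompact_closed doubling_totally_bounded. Qed.

End MetricMeasure.

(** * Upper gradients *)

(** The supremum of the good points is itself good by the closure hypothesis, and the forward step
    forbids it to lie below L. *)
Lemma real_induction {R : realType} (P : R -> Prop) (L : R) : 0 <= L -> P 0 ->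
  (forall t, 0 <= t -> t < L -> P t -> exists s, t < s /\ s <= L /\ P s) ->
  (forall t, 0 <= t -> t <= L ->
    (forall e, 0 < e -> exists s, 0 <= s /\ t - e < s /\ s <= t /\ P s) -> P t) ->
  P L.
Proof.
move=> L0 P0 fwd cls; pose S := [set t | 0 <= t /\ t <= L /\ P t].
have S0 : S 0 by [].
have ubS : has_ubound S by exists L => t [_ []].
have sS : has_sup S by split=> //; exists 0.
have t0 : 0 <= sup S by apply: ub_le_sup.
have tL : sup S <= L by apply: ge_sup; [exists 0 | move=> t [_ []]].
have PS : P (sup S).
  apply: cls => // e e0; have [s [s0 [sL Ps]] es] := sup_adherent e0 sS.
  by exists s; do !split => //; apply: ub_le_sup.
move: tL; rewrite le_eqVlt => /predU1P[<-//|tL].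
have [s [ts [sL Ps]]] := fwd _ t0 tL PS.
suff : s <= sup S by rewrite leNgt ts.
by apply: ub_le_sup => //; do !split => //; apply: le_trans t0 (ltW ts).
Qed.

Section UpperGradient.
Context {R : realType} {disp : measure_display} {X : measurableType disp}.
Variable (d : X -> X -> R).
Hypothesis dm : is_metric d.
Hypothesis dB : borel_wrt_metric d.

Lemma arclength_curve_lip (gamma : R -> X) (L s t : R) :
  arclength_curve d gamma L -> 0 <= s -> s <= t -> t <= L ->
  d (gamma s) (gamma t) <= t - s.
Proof.
move=> [_ arc] s0 st tL; rewrite -lee_fin -(arc s t s0 st tL).
apply: ereal_sup_ubound; exists 1%N, (fun i => if i is 0%N then s else t).
by split=> // [[]//|]; rewrite big_ord1.
Qed.

Variables u g : X -> R.
Hypothesis g0 : forall x, 0 <= g x.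
Hypothesis g_lsc : forall x e, 0 < e -> near_pt d x [set y | g x - e < g y].
Hypothesis u_loc : forall x e, 0 < e ->
  near_pt d x [set y | `|u x - u y| <= (g x + e) * d x y].

Section AlongCurve.
Variables (gamma : R -> X) (L : R).
Hypothesis arc : arclength_curve d gamma L.
(** The curve is extended by constants beyond [0, L]; it becomes 1-Lipschitz on the whole line, and
    [G] inherits lower semicontinuity there. *)
Let clamp (t : R) := Num.min L (Num.max 0 t).
Let G t := g (gamma (clamp t)).
Let I t := (\int[lebesgue_measure]_(s in `[0%R, t]) (G s)%:E)%E.

Let L0 : 0 <= L. Proof. by case: arc. Qed.

Let clampE t : 0 <= t -> t <= L -> clamp t = t.
Proof. by move=> t0 tL; rewrite /clamp max_r// min_r. Qed.

Let gamma_lip s t : d (gamma (clamp s)) (gamma (clamp t)) <= `|s - t|.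
Proof.
wlog st : s t / s <= t.
  move=> H; case: (leP s t) => [/H//|/ltW /H].
  by rewrite distrC dist_sym.
have [c1 [c2 [c3 c4]]] : 0 <= clamp s /\ clamp s <= clamp t /\ clamp t <= L /\
    clamp t - clamp s <= t - s.
  move: L0 st; rewrite /clamp !minEle !maxEle => LL st.
  by do ! case: ifPn; rewrite -?ltNge => *; do !split; lra.
apply: le_trans (arclength_curve_lip arc c1 c2 c3) _; apply: le_trans c4 _.
by rewrite distrC ler_norm.
Qed.

Let near_gamma t (A : set X) : near_pt d (gamma (clamp t)) A ->
  exists r, 0 < r /\ forall s, `|s - t| < r -> A (gamma (clamp s)).
Proof.
move=> [r /= r0 rA]; exists r; split=> // s st; apply: rA; rewrite /oball /=.
by apply: le_lt_trans (gamma_lip _ _) _; rewrite distrC.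
Qed.

Let mG (D : set R) : measurable D -> measurable_fun D (fun s => (G s)%:E).
Proof.
move=> mD; apply/measurable_EFinP; apply: (@measurable_funS _ _ _ _ setT) => //.
apply: (measurability _ (RGenOInfty.measurableE R)).
move=> /= _ [_ [a ->]] <-; apply: measurableI => //; apply: open_measurable.
rewrite openE => t /=; rewrite in_itv /= andbT => at_.
have Ga : 0 < G t - a by rewrite subr_gt0.
have [r [r0 rA]] := near_gamma (g_lsc (gamma (clamp t)) Ga).
apply/nbhs_ballP; exists r => // s; rewrite /ball /= distrC => /rA /=.
by rewrite in_itv /= andbT -/(G s) -/(G t); lra.
Qed.

Let I_split s t c : 0 <= s -> s <= t -> (forall r, s < r -> r <= t -> c <= G r) ->
  (I s + (c * (t - s))%:E <= I t)%E.
Proof.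
move=> s0 st cG.
have -> : I t = (I s + \int[lebesgue_measure]_(r in `]s, t]) (G r)%:E)%E.
  rewrite /I -ge0_integral_setU//.
  - by rewrite (@itv_bndbnd_setU _ _ (BLeft 0) (BRight s) (BRight t)).
  - by apply: mG; apply: measurableU.
  - by move=> r _; rewrite lee_fin /G g0.
  - rewrite disj_set2E; apply/eqP/seteqP; split=> // r [] /=.
    by rewrite !in_itv /=; lra.
rewrite leeD2l//; pose c' := Num.max 0 c.
apply: (@le_trans _ _ (\int[lebesgue_measure]_(r in `]s, t]) c'%:E)%E).
  rewrite integral_cst //= lebesgue_measure_itv /= lte_fin.
  case: ltP => [st'|ts].
    by rewrite -EFinB -EFinM lee_fin ler_wpM2r ?subr_ge0// le_max lexx orbT.
  by rewrite mule0 lee_fin (_ : t = s) ?subrr ?mulr0//; apply/eqP; rewrite eq_le st ts.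
apply: ge0_le_integral => //.
- by move=> r _; rewrite lee_fin le_max lexx.
- exact: mG.
- move=> r /=; rewrite in_itv /= => /andP[sr rt].
  by rewrite lee_fin ge_max g0 cG.
Qed.

(** Real induction on t for |u(gamma 0) - u(gamma t)| <= I t + e t replaces differentiation along
    the curve. Just after t, semicontinuity makes the integral grow at rate at least G t - e/2,
    while u varies at rate at most G t + e/2; the e t term pays for the gap. At limits from the left
    the local bound on u gives continuity. *)
Lemma upper_gradient_along :
  (`|u (gamma 0) - u (gamma L)|%:E <= line_integral g gamma L)%E.
Proof.
have -> : line_integral g gamma L = I L.
  rewrite /line_integral /I; transitivity
    (\int[lebesgue_measure]_(t in `[0%R, L]) (g (gamma t))%:E)%E.
    by congr (integral _ _ _); apply/seteqP; split=> t /=; rewrite in_itv.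
  apply: eq_integral => t; rewrite inE /= in_itv /= => /andP[t0 tL].
  by rewrite /G clampE.
apply/lee_addgt0Pr => e' e'0; set e := e' / (L + 1).
have e0 : 0 < e by rewrite divr_gt0// ltr_wpDl.
have eL : e * L <= e'.
  have <- : e * (L + 1) = e' by rewrite divfK// gt_eqF// ltr_wpDl.
  by apply: ler_wpM2l; [exact: ltW | rewrite lerDl].
suff H : (`|u (gamma 0) - u (gamma L)|%:E <= I L + (e * L)%:E)%E.
  by apply: le_trans H _; rewrite leeD2l// lee_fin.
have I0 t : (0 <= I t)%E by apply: integral_ge0 => s _; rewrite lee_fin /G g0.
apply: (real_induction (P := fun t => `|u (gamma 0) - u (gamma t)|%:E <= I t + (e * t)%:E)%E) => //.
- by rewrite subrr normr0 mulr0 adde0.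
- move=> t t0 tL Pt; have e2 : 0 < e / 2 by lra.
  have [r [r0 rG]] := near_gamma (g_lsc (gamma (clamp t)) e2).
  have [r' [r'0 ru]] := near_gamma (u_loc (gamma (clamp t)) e2).
  pose s := Num.min L (t + Num.min r r' / 2).
  have [s1 [s2 [s3 s4]]] : t < s /\ s <= L /\ s < t + r /\ s < t + r'.
    by rewrite /s !minEle; do ! case: ifPn; rewrite -?ltNge => *; do !split; lra.
  exists s; do 2! split=> //.
  have s0 : 0 <= s by lra.
  have Is : (I t + ((G t - e / 2) * (s - t))%:E <= I s)%E.
    apply: I_split => //; first exact: ltW.
    move=> v tv vs; have /rG /= : `|v - t| < r by rewrite gtr0_norm ?subr_gt0//; lra.
    by rewrite -/(G v) -/(G t); lra.
  apply: le_trans (leeD2r _ Is).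
  have us : `|u (gamma t) - u (gamma s)| <= (G t + e / 2) * (s - t).
    have /ru /= : `|s - t| < r' by rewrite gtr0_norm ?subr_gt0//; lra.
    rewrite /G !clampE// ?(ltW tL)// => h; apply: le_trans h _.
    apply: ler_wpM2l; first by rewrite addr_ge0 ?g0 ?ltW.
    by apply: (arclength_curve_lip arc) => //; exact: ltW.
  have tri : `|u (gamma 0) - u (gamma s)| <=
     `|u (gamma 0) - u (gamma t)| + (G t + e / 2) * (s - t).
    by apply: le_trans (ler_distD (u (gamma t)) _ _) _; rewrite lerD2l.
  apply: (@le_trans _ _ (`|u (gamma 0) - u (gamma t)|%:E + ((G t + e / 2) * (s - t))%:E)%E).
    by rewrite -EFinD lee_fin.
  apply: le_trans (leeD2r _ Pt) _; move: (I t) => It; rewrite -!addeA leeD2l// -!EFinD lee_fin; lra.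
- move=> t t0 tL H; apply/lee_addgt0Pr => k k0.
  have [r [r0 ru]] := near_gamma (u_loc (gamma (clamp t)) ltr01).
  pose r' := Num.min r (k / (G t + 1)).
  have G1 : 0 < G t + 1 by rewrite ltr_wpDl ?g0.
  have r'0 : 0 < r' by rewrite lt_min r0 divr_gt0.
  have [s [s0 [ts [st Ps]]]] := H _ r'0.
  have := I_split s0 st (c := 0) (fun _ _ _ => g0 _); rewrite mul0r adde0 => Ist.
  have us : `|u (gamma t) - u (gamma s)| <= k.
    have /ru /= : `|s - t| < r.
      by rewrite distrC ger0_norm ?subr_ge0//; move: ts; rewrite /r' minEle; case: ifPn; lra.
    rewrite -/(G t) !clampE//; last exact: le_trans tL.
    move=> h; apply: le_trans h _.
    rewrite mulrC -ler_pdivlMr//.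
    rewrite (dist_sym dm); apply: le_trans (arclength_curve_lip arc s0 st tL) _.
    have : r' <= k / (G t + 1) by rewrite ge_min lexx orbT.
    by move: ts; set w := k / _; lra.
  have tri : `|u (gamma 0) - u (gamma t)| <= `|u (gamma 0) - u (gamma s)| + k.
    by apply: le_trans (ler_distD (u (gamma s)) _ _) _; rewrite lerD2l distrC.
  apply: (@le_trans _ _ (`|u (gamma 0) - u (gamma s)|%:E + k%:E)%E).
    by rewrite -EFinD lee_fin.
  rewrite leeD2r//; apply: le_trans Ps _; rewrite leeD// lee_fin ler_wpM2l// ltW//.
Qed.

End AlongCurve.

Lemma upper_gradient_lsc : upper_gradient d u g.
Proof.
split; first exact: (measurable_lsc dB g_lsc).
by split=> // gamma L; move=> arc; apply: upper_gradient_along arc.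
Qed.

End UpperGradient.

(** * Powers of the distance *)

Section RealEstimates.
Context {R : realType}.
Implicit Types a b c s t w x y p q th : R.

Lemma powR_expR x a : 0 < x -> x `^ a = expR (a * ln x).
Proof. by move=> x0; rewrite /powR gt_eqF. Qed.

Lemma powR_gt0D x a b : 0 < x -> x `^ (a + b) = x `^ a * x `^ b.
Proof. by move=> x0; rewrite powRD// (gt_eqF x0) implybT. Qed.

Lemma le0_ger_powR x y a : a <= 0 -> 0 < x -> x <= y -> y `^ a <= x `^ a.
Proof.
move=> a0 x0 xy; have y0 := lt_le_trans x0 xy.
by rewrite !powR_expR// ler_expR ler_wnM2l// ler_ln.
Qed.

Lemma powR_le1 x a : 0 < x -> x <= 1 -> 0 <= a -> x `^ a <= 1.
Proof.
move=> x0 x1 a0; rewrite powR_expR// -expR0 ler_expR.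
by rewrite mulr_ge0_le0// ln_le0.
Qed.

Lemma ge0_le_powR x y a : 0 <= a -> 0 <= x -> x <= y -> x `^ a <= y `^ a.
Proof. by move=> a0 x0 xy; apply: ge0_ler_powR; rewrite ?nnegrE// (le_trans x0). Qed.

Lemma powR_add_le x y p : 0 <= p -> 0 <= x -> 0 <= y ->
  (x + y) `^ p <= 2 `^ p * (x `^ p + y `^ p).
Proof.
move=> p0 x0 y0.
have H c z : 0 <= c -> 0 <= z -> c <= z -> (c + z) `^ p <= 2 `^ p * z `^ p.
  by move=> c0 z0 cz; rewrite -powRM//; apply: ge0_le_powR; lra.
have [xy|/ltW yx] := leP x y.
  apply: le_trans (H _ _ x0 y0 xy) _; apply: ler_wpM2l; first exact: powR_ge0.
  by rewrite lerDr powR_ge0.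
rewrite addrC; apply: le_trans (H _ _ y0 x0 yx) _.
apply: ler_wpM2l; first exact: powR_ge0.
by rewrite lerDl powR_ge0.
Qed.

(** For a base at most 1 and [p >= 1] the power is at most the base. The bound is a quarter because
    two such terms must add up to the 1/2 of the absorption. *)
Lemma small_powR p k C : 1 <= p -> 0 < k -> 0 < C ->
  exists2 th, 0 < th <= 1 & (k * th) `^ p * C <= 4^-1.
Proof.
move=> p1 k0 C0; exists (Num.min 1 (k^-1 * Num.min 1 (4^-1 / C))).
  rewrite ge_min lexx andbT lt_min ltr01 mulr_gt0 ?invr_gt0// lt_min ltr01/=.
  by rewrite divr_gt0// invr_gt0.
set th := Num.min 1 _; have m0 : 0 < Num.min 1 (4^-1 / C).
  by rewrite lt_min ltr01 divr_gt0// invr_gt0.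
have kt : k * th <= Num.min 1 (4^-1 / C).
  rewrite -ler_pdivlMl// /th ge_min lexx orbT//.
have th0 : 0 < th by rewrite lt_min ltr01 mulr_gt0// invr_gt0.
have kt0 : 0 < k * th by rewrite mulr_gt0.
move: kt; rewrite le_min => /andP[kt1 kt2].
rewrite -ler_pdivlMr//; apply: le_trans kt2.
rewrite -[leRHS]powRr1 ?(ltW kt0)// -(subrK 1 p) powR_gt0D//.
by rewrite ler_piMl ?powR_ge0// powR_le1// subr_ge0.
Qed.

(** This and the next two are mean value bounds with constants taken from the values at the two
    endpoints. As one endpoint tends to the other, the constant tends to the pointwise slope, which
    is what the local condition on an upper gradient asks for. *)
Lemma expR_dist_le x y : `|expR x - expR y| <= Num.max (expR x) (expR y) * `|x - y|.
Proof.
wlog xy : x y / y <= x.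
  by move=> H; have [/H|/ltW/H //] := leP y x; rewrite distrC maxC (distrC x).
rewrite max_l ?ler_expR// !ger0_norm ?subr_ge0 ?ler_expR//.
have -> : expR x - expR y = expR x * (1 - expR (- (x - y))).
  by rewrite mulrBr mulr1 -expRD opprB addrCA subrr addr0.
rewrite ler_wpM2l ?expR_ge0//.
by have := expR_ge1Dx (- (x - y)); lra.
Qed.

Lemma ln_dist_le s t : 0 < s -> 0 < t -> `|ln s - ln t| <= `|s - t| / Num.min s t.
Proof.
wlog st : s t / t <= s.
  move=> H s0 t0; case/orP: (le_total t s) => ts; first exact: H.
  by rewrite distrC (distrC s) minC; exact: H.
move=> s0 t0; rewrite min_r// !ger0_norm ?subr_ge0 ?ler_ln//.
rewrite -ln_div// mulrBl divff ?gt_eqF//.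
have /le_ln1Dx : -1 < s / t - 1 by have := divr_gt0 s0 t0; lra.
by rewrite addrCA subrr addr0.
Qed.

Lemma exprn_dist_le n x y : 0 <= x -> 0 <= y ->
  `|x ^+ n.+1 - y ^+ n.+1| <= n.+1%:R * Num.max x y ^+ n * `|x - y|.
Proof.
move=> x0 y0; have m0 : 0 <= Num.max x y by rewrite le_max x0.
elim: n => [|n IH]; first by rewrite !expr1 expr0 mulr1 mul1r.
have -> : x ^+ n.+2 - y ^+ n.+2 = x * (x ^+ n.+1 - y ^+ n.+1) + (x - y) * y ^+ n.+1.
  by rewrite !exprS; ring.
apply: le_trans (ler_normD _ _) _; rewrite !normrM (ger0_norm x0).
rewrite (ger0_norm (exprn_ge0 _ y0)).
have -> : n.+2%:R * Num.max x y ^+ n.+1 * `|x - y| =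
  Num.max x y * (n.+1%:R * Num.max x y ^+ n * `|x - y|) +
  `|x - y| * Num.max x y ^+ n.+1 by rewrite exprS -[n.+2]addn1 natrD; ring.
apply: lerD.
  by apply: ler_pM => //; rewrite le_max lexx.
by apply: ler_wpM2l => //; apply: lerXn2r; rewrite ?nnegrE// le_max lexx orbT.
Qed.

(* [tent b rho t = min ((t / rho)^b, (t / rho)^-b)]: a two-sided power, with
   logarithmic slope [b] and peak at [rho]. *)
Definition tent b rho t := expR (- (b * `|ln t - ln rho|)).

Section Tent.
Variables b rho : R.
Hypotheses (b0 : 0 < b) (rho0 : 0 < rho).
Local Notation psi := (tent b rho).

Lemma tent_gt0 t : 0 < psi t. Proof. exact: expR_gt0. Qed.

Lemma tent_le1 t : psi t <= 1.
Proof.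
by rewrite /tent -expR0 ler_expR oppr_le0 mulr_ge0// ltW.
Qed.

Lemma tent_dist_le s t : 0 < s -> 0 < t ->
  `|psi s - psi t| <= b * Num.max (psi s) (psi t) * (`|s - t| / Num.min s t).
Proof.
move=> s0 t0; apply: le_trans (expR_dist_le _ _) _.
rewrite -/(psi s) -/(psi t) [b * Num.max _ _]mulrC -mulrA; apply: ler_wpM2l.
  by rewrite le_max (ltW (tent_gt0 s)).
rewrite opprK addrC -mulrBr normrM (gtr0_norm b0); apply: ler_wpM2l; first exact: ltW.
apply: le_trans (ln_dist_le s0 t0).
apply: le_trans (ler_dist_dist _ _) _.
rewrite (_ : _ - _ - _ = ln t - ln s); last by ring.
by rewrite distrC.
Qed.

(** The tent lies below both of its branches everywhere. The first bound serves the outer ball, the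
    second the balls of the cover. *)
Lemma tent_powR p t : 0 <= p -> 0 < t ->
  (psi t `^ p <= rho `^ (b * p) * t `^ (- (b * p))) *
  (psi t `^ p <= rho `^ (- (b * p)) * t `^ (b * p)).
Proof.
move=> p0 t0; rewrite /tent -expRM !powR_expR// -!expRD !ler_expR.
have bp : 0 <= b * p by rewrite mulr_ge0// ltW.
have H x : - (b * `|ln t - ln rho|) * p <= x * (b * p) = (- `|ln t - ln rho| * (b * p) <= x * (b * p)).
  by congr (_ <= _); ring.
have H1 := ler_norm (ln t - ln rho); have H2 := ler_norm (- (ln t - ln rho)).
rewrite normrN in H2.
rewrite (_ : b * p * ln rho + - (b * p) * ln t = (ln rho - ln t) * (b * p)); last by ring.
rewrite (_ : - (b * p) * ln rho + b * p * ln t = (ln t - ln rho) * (b * p)); last by ring.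
by rewrite !H; split; apply: ler_wpM2r => //; lra.
Qed.

Lemma tent_powR_ge p t r : 0 <= p -> rho <= t -> t <= r ->
  rho `^ (b * p) * r `^ (- (b * p)) <= psi t `^ p.
Proof.
move=> p0 rt tr; have t0 := lt_le_trans rho0 rt; have r0 := lt_le_trans t0 tr.
rewrite /tent -expRM !powR_expR// -!expRD !ler_expR ger0_norm ?subr_ge0 ?ler_ln//.
have bp : 0 <= b * p by rewrite mulr_ge0// ltW.
have : (b * p) * ln t <= (b * p) * ln r by rewrite ler_wpM2l// ler_ln.
rewrite mulrBr; lra.
Qed.

End Tent.

(* Either [t <= th * w * s], and the left-hand side is absorbed by the first
   term, or [t] is comparable to [w * s] and the power [w^n] compensates for
   the possibly negative power of [t]. *)
Lemma cutoff_term p q a M n th s t w y : 1 <= p -> 0 < th -> 0 < s ->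
  0 < t -> t <= 5 * s -> 0 <= w <= 1 -> 0 <= y -> 0 <= M ->
  y `^ p <= M * t `^ a -> 0 <= p - q + a + n%:R * p ->
  (w ^+ n * s^-1 * y) `^ p * t `^ (p - q) <=
    th `^ p * ((w ^+ n.+1 * y) `^ p * t `^ (- q)) +
    M * (5 `^ (p - q + a) + th `^ (p - q + a)) * s `^ (a - q).
Proof.
move=> p1 th0 s0 t0 ts /andP[w0 w1] y0 M0 yM ne.
have p0 : 0 <= p by lra.
have [s0' t0' th0'] : [/\ 0 <= s, 0 <= t & 0 <= th] by split; exact: ltW.
have wn0 : 0 <= w ^+ n by rewrite exprn_ge0.
have K0 x : 0 <= 5 `^ x + th `^ x by rewrite addr_ge0 ?powR_ge0.
have [tw|/ltW wt] := leP t (th * w * s).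
  rewrite -[leLHS]addr0; apply: lerD; last by rewrite !mulr_ge0 ?powR_ge0.
  rewrite powR_gt0D// mulrA -powRM ?mulr_ge0 ?invr_ge0//.
  rewrite mulrA -powRM ?mulr_ge0 ?exprn_ge0//.
  apply: ler_wpM2r; first exact: powR_ge0.
  apply: ge0_le_powR => //; first by rewrite !mulr_ge0 ?invr_ge0// ltW.
  rewrite exprSr (_ : _ * y * t = (w ^+ n * y) * (t / s)); last by ring.
  rewrite (_ : th * _ = (w ^+ n * y) * (th * w)); last by ring.
  by apply: ler_wpM2l; [rewrite mulr_ge0 | rewrite ler_pdivrMr].
rewrite -[leLHS]add0r; apply: lerD; first by rewrite !mulr_ge0 ?powR_ge0.
set e := p - q + a in ne *.
have key : (w ^+ n) `^ p * t `^ e <= (5 `^ e + th `^ e) * s `^ e.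
  (* The sign of the exponent selects the useful bound on t: the upper bound 5 s, or the lower bound
     th w s, whose factor w^e is compensated by w^(n p) because n p + e >= 0. *)
  have [e0|e0] := leP 0 e.
    apply: (@le_trans _ _ (1 * (5 `^ e * s `^ e))).
      apply: ler_pM; rewrite ?powR_ge0//.
        apply: (@le_trans _ _ (1 `^ p)); last by rewrite powR1.
        by apply: ge0_le_powR => //; rewrite exprn_ile1.
      by rewrite -powRM//; apply: ge0_le_powR => //; exact: ltW.
    by rewrite mul1r; apply: ler_wpM2r; rewrite ?powR_ge0// lerDl powR_ge0.
  have : 0 < n%:R * p by lra.
  case: n => [|m] in wn0 ne *; first by rewrite mul0r ltxx.
  move=> _; move: (w0); rewrite le_eqVlt => /predU1P[<-|w0p].
    by rewrite expr0n/= powR0 ?gt_eqF ?mul0r ?mulr_ge0 ?powR_ge0//; lra.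
  have tws : t `^ e <= th `^ e * w `^ e * s `^ e.
    rewrite -!powRM ?mulr_ge0//.
    by apply: le0_ger_powR; rewrite ?(ltW e0)// !mulr_gt0.
  apply: le_trans (ler_wpM2l (powR_ge0 _ _) tws) _.
  rewrite !mulrA; apply: ler_wpM2r; first exact: powR_ge0.
  rewrite -powR_mulrn// -powRrM (_ : _ * _ * _ = (w `^ (m.+1%:R * p) * w `^ e) * th `^ e); last by ring.
  rewrite -powR_gt0D//; apply: (@le_trans _ _ (1 * th `^ e)).
    by apply: ler_wpM2r; rewrite ?powR_ge0// powR_le1//; lra.
  by rewrite mul1r lerDr powR_ge0.
rewrite !powRM ?mulr_ge0 ?invr_ge0 ?(ltW s0)//.
have -> : s^-1 `^ p = s `^ (- p) by rewrite -powR_inv1// -powRrM mulN1r.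
apply: (@le_trans _ _ ((w ^+ n) `^ p * s `^ (- p) * (M * t `^ a) * t `^ (p - q))).
  apply: ler_wpM2r; first exact: powR_ge0.
  by apply: ler_wpM2l; rewrite ?mulr_ge0 ?powR_ge0.
have E1 (A B C D : R) : A * B * (M * C) * D = (M * B) * (A * (D * C)) by ring.
rewrite E1 -powR_gt0D// -/e.
apply: le_trans (ler_wpM2l _ key) _; first by rewrite mulr_ge0 ?powR_ge0.
have E2 (A B C : R) : M * B * (A * C) = M * A * (B * C) by ring.
rewrite E2 -powR_gt0D// /e (_ : - p + _ = a - q) ?lexx//; ring.
Qed.

(** Splitting the p-th power costs 2^p. The tent part is exactly a multiple b^p of the Hardy
    integrand, since t^(-p) t^(p-q) = t^(-q); the cutoff part is [cutoff_term]. The coefficient of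
    the Hardy integrand is what [absorb] makes small. *)
Lemma gradient_term p q a b M n th s t w y : 1 <= p -> 0 < th -> 0 < s ->
  0 < t -> t <= 5 * s -> 0 <= w <= 1 -> 0 <= y -> 0 <= M -> 0 < b ->
  y `^ p <= M * t `^ a -> 0 <= p - q + a + n%:R * p ->
  (n.+1%:R * w ^+ n * s^-1 * y + b * w ^+ n.+1 * y / t) `^ p * t `^ (p - q) <=
    ((2 * n.+1%:R * th) `^ p + (2 * b) `^ p) * ((w ^+ n.+1 * y) `^ p * t `^ (- q)) +
    (2 * n.+1%:R) `^ p * (M * (5 `^ (p - q + a) + th `^ (p - q + a)) * s `^ (a - q)).
Proof.
move=> p1 th0 s0 t0 ts w01 y0 M0 b0 yM ne; have /andP[w0 w1] := w01.
have [t0' th0' b0'] : [/\ 0 <= t, 0 <= th & 0 <= b] by split; exact: ltW.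
have s0' : 0 <= s by exact: ltW.
have := cutoff_term p1 th0 s0 t0 ts w01 y0 M0 yM ne.
set U := _ `^ p * t `^ (- q); set V := M * _ * _ => H.
apply: (@le_trans _ _ (2 `^ p * ((n.+1%:R * w ^+ n * s^-1 * y) `^ p +
   (b * w ^+ n.+1 * y / t) `^ p) * t `^ (p - q))).
  apply: ler_wpM2r; first exact: powR_ge0.
  by apply: powR_add_le; rewrite ?mulr_ge0 ?exprn_ge0 ?invr_ge0//; lra.
have -> : (b * w ^+ n.+1 * y / t) `^ p = b `^ p * (w ^+ n.+1 * y) `^ p * t `^ (- p).
  rewrite -mulrA -mulrA !powRM ?mulr_ge0 ?exprn_ge0 ?invr_ge0//.
  by rewrite -powR_inv1// -powRrM mulN1r; ring.
have -> : (n.+1%:R * w ^+ n * s^-1 * y) `^ p = n.+1%:R `^ p * (w ^+ n / s * y) `^ p.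
  by rewrite -powRM ?mulr_ge0 ?exprn_ge0 ?invr_ge0//; congr (_ `^ _); ring.
have UE : (w ^+ n.+1 * y) `^ p * (t `^ (- p) * t `^ (p - q)) = U.
  by rewrite -powR_gt0D// (_ : - p + (p - q) = - q)//; ring.
have -> : (2 * n.+1%:R * th) `^ p = 2 `^ p * n.+1%:R `^ p * th `^ p.
  by rewrite !powRM ?mulr_ge0.
have -> : (2 * b) `^ p = 2 `^ p * b `^ p by rewrite powRM.
have -> : (2 * n.+1%:R) `^ p = 2 `^ p * n.+1%:R `^ p by rewrite powRM.
have k0 : 0 <= 2 `^ p * n.+1%:R `^ p by rewrite mulr_ge0 ?powR_ge0.
have E (A B C Z Y S T : R) : A * (B * Z + C * Y * S) * T =
  A * B * (Z * T) + A * C * (Y * (S * T)) by ring.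
rewrite E UE; apply: le_trans (lerD (ler_wpM2l k0 H) (lexx _)) _.
by rewrite le_eqVlt; apply/orP; left; apply/eqP; ring.
Qed.

End RealEstimates.

(** * Test functions *)

Section ProductTestFunction.
Context {R : realType} {disp : measure_display} {X : measurableType disp}.
Variable (d : X -> X -> R).
Hypothesis dm : is_metric d.
Hypothesis dB : borel_wrt_metric d.
Variables (w D h : X -> R) (Lw dl b rho : R) (n : nat).
Hypothesis w01 : forall x, 0 <= w x <= 1.
Hypothesis w_lip : forall x y, `|w x - w y| <= Lw * d x y.
Hypothesis D_lip : forall x y, `|D x - D y| <= d x y.
Hypotheses (dl0 : 0 < dl) (D_ge : forall x, dl <= D x).
Hypothesis h0 : forall x, 0 <= h x.
Hypothesis w_loc : forall x, near_pt d x [set y | `|w x - w y| <= h x * d x y].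
Hypothesis h_lsc : forall x, near_pt d x [set y | h x <= h y].
Hypotheses (b0 : 0 < b) (rho0 : 0 < rho).

Definition test_fun x := w x ^+ n.+1 * tent b rho (D x).
Definition test_grad x := n.+1%:R * w x ^+ n * h x * tent b rho (D x) +
  b * w x ^+ n.+1 * tent b rho (D x) / D x.

Let T x := tent b rho (D x).
Let T0 x : 0 < T x. Proof. exact: tent_gt0. Qed.

Let D0 x : 0 < D x. Proof. exact: lt_le_trans (D_ge x). Qed.

Let w0 x : 0 <= w x. Proof. by case/andP: (w01 x). Qed.

Let T_dist x y : `|T x - T y| <= b * Num.max (T x) (T y) / Num.min (D x) (D y) * d x y.
Proof.
apply: le_trans (tent_dist_le rho b0 (D0 x) (D0 y)) _.
rewrite -[leRHS]mulrA; apply: ler_wpM2l.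
  by rewrite mulr_ge0 ?(ltW b0)// le_max (ltW (T0 x)).
rewrite mulrC ler_wpM2l// invr_ge0 le_min.
by rewrite !ltW.
Qed.

Let T_lip x y : `|T x - T y| <= b / dl * d x y.
Proof.
apply: le_trans (T_dist x y) _; apply: ler_wpM2r; first exact: dist_ge0.
apply: ler_pM.
- by rewrite mulr_ge0 ?(ltW b0)// le_max (ltW (T0 x)).
- by rewrite invr_ge0 le_min !ltW.
- by rewrite ler_piMr ?(ltW b0)// ge_max !tent_le1.
- by rewrite lef_pV2 ?posrE ?lt_min ?dl0 ?D0// le_min !D_ge.
Qed.

Let near_maxr (f : X -> R) L x : (forall x y, `|f x - f y| <= L * d x y) ->
  Num.max (f x) (f y) @[y --> near_pt d x] --> f x.
Proof.
move=> fL; rewrite -[X in _ --> X]maxxx.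
apply: (near_pt_cvg dm (f := fun y => Num.max (f x) (f y)) (L := L)) => y.
apply: le_trans (fL x y); rewrite maxxx.
by rewrite maxEle; case: ifP => // _; rewrite subrr normr0.
Qed.

Let near_minr (f : X -> R) L x : (forall x y, `|f x - f y| <= L * d x y) ->
  Num.min (f x) (f y) @[y --> near_pt d x] --> f x.
Proof.
move=> fL; rewrite -[X in _ --> X]minxx.
apply: (near_pt_cvg dm (f := fun y => Num.min (f x) (f y)) (L := L)) => y.
apply: le_trans (fL x y); rewrite minxx.
by rewrite minEle; case: ifP => // _; rewrite subrr normr0.
Qed.

Let D_lip1 x y : `|D x - D y| <= 1 * d x y.
Proof. by rewrite mul1r. Qed.

(** [h x] stays frozen because [h] is only semicontinuous. The slots W, V, E receive the values at y
    for semicontinuity, and maxima or minima over x and y for the slope bound. *)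
Let cvg_grad x (W V E : X -> R) : W @ near_pt d x --> w x ->
  V @ near_pt d x --> T x -> E @ near_pt d x --> D x ->
  (n.+1%:R * W y ^+ n * h x * V y + b * W y ^+ n.+1 * V y / E y) @[y --> near_pt d x]
    --> test_grad x.
Proof.
move=> Ww VT ED.
have WX k : (W y ^+ k) @[y --> near_pt d x] --> w x ^+ k.
  by apply: (@continuous_cvg _ _ _ _ _ W (fun z : R => z ^+ k) (w x)) => //; exact: exprn_continuous.
apply: cvgD.
  by do ! apply: cvgM => //; exact: cvg_cst.
apply: cvgM; first by do ! apply: cvgM => //; exact: cvg_cst.
by apply: cvgV => //; rewrite gt_eqF.
Qed.

(** Product rule, with endpoint maxima and minima in place of derivatives. The loss against
    [test_grad x] tends to 0 as y tends to x and fits into the e that [upper_gradient_lsc]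
    allows. *)
Lemma test_fun_upper_gradient : upper_gradient d test_fun test_grad.
Proof.
have g0 x : 0 <= test_grad x.
  by rewrite addr_ge0// !mulr_ge0 ?invr_ge0 ?exprn_ge0 ?(ltW b0) ?(ltW (D0 x)) ?(ltW (T0 x)).
apply: upper_gradient_lsc => // x e e0.
  have /cvgr_gt/(_ (test_grad x - e)) := cvg_grad
    (near_pt_cvg dm (w_lip x)) (near_pt_cvg dm (T_lip x)) (near_pt_cvg dm (D_lip1 x)).
  move=> /(_ ltac:(by rewrite ltrBlDr ltrDl)) H.
  near=> y => /=.
  have /= H1 : test_grad x - e < n.+1%:R * w y ^+ n * h x * T y + b * w y ^+ n.+1 * T y / D y.
    by near: y.
  apply: lt_le_trans H1 _; rewrite /test_grad -/(T y) lerD2r ler_wpM2r ?(ltW (T0 y))//.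
  rewrite ler_wpM2l ?mulr_ge0 ?exprn_ge0//.
  by near: y; exact: h_lsc.
have /cvgr_lt/(_ (test_grad x + e)) := cvg_grad
    (near_maxr w_lip (x := x)) (near_maxr T_lip (x := x)) (near_minr D_lip1 (x := x)).
move=> /(_ ltac:(by rewrite ltrDl)) H.
near=> y => /=.
have H2 : `|w x - w y| <= h x * d x y by near: y; exact: w_loc.
have : n.+1%:R * Num.max (w x) (w y) ^+ n * h x * Num.max (T x) (T y) +
    b * Num.max (w x) (w y) ^+ n.+1 * Num.max (T x) (T y) / Num.min (D x) (D y) <
    test_grad x + e by near: y.
set W := Num.max (w x) (w y); set V := Num.max (T x) (T y).
set E := Num.min (D x) (D y) => H1.
have W0 : 0 <= W by rewrite le_max w0.
have V0 : 0 <= V by rewrite le_max (ltW (T0 x)).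
apply: le_trans (ler_wpM2r (dist_ge0 dm x y) (ltW H1)).
rewrite /test_fun -/(T x) -/(T y).
have -> : w x ^+ n.+1 * T x - w y ^+ n.+1 * T y =
  (w x ^+ n.+1 - w y ^+ n.+1) * T x + w y ^+ n.+1 * (T x - T y) by ring.
apply: le_trans (ler_normD _ _) _; rewrite !normrM mulrDl; apply: lerD.
  rewrite (gtr0_norm (T0 x)) [leRHS]mulrAC; apply: ler_pM => //.
  - exact: ltW.
  - apply: le_trans (exprn_dist_le n (w0 x) (w0 y)) _; rewrite -/W -[leRHS]mulrA.
    by rewrite ler_wpM2l// mulr_ge0 ?exprn_ge0.
  - by rewrite le_max lexx.
rewrite ger0_norm ?exprn_ge0//.
apply: (@le_trans _ _ (W ^+ n.+1 * (b * V / E * d x y))).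
  by apply: ler_pM; rewrite ?exprn_ge0// lerXn2r ?nnegrE// le_max lexx orbT.
by rewrite le_eqVlt; apply/orP; left; apply/eqP; ring.
Unshelve. all: by end_near. Qed.

Lemma test_fun_lipschitz : Defs.lipschitz d test_fun.
Proof.
exists (n.+1%:R * Lw + b / dl) => x y.
rewrite /test_fun -/(T x) -/(T y).
have -> : w x ^+ n.+1 * T x - w y ^+ n.+1 * T y =
  (w x ^+ n.+1 - w y ^+ n.+1) * T x + w y ^+ n.+1 * (T x - T y) by ring.
apply: le_trans (ler_normD _ _) _; rewrite !normrM mulrDl; apply: lerD.
  rewrite (gtr0_norm (T0 x)) -[leRHS]mulr1; apply: ler_pM => //; [exact: ltW| |exact: tent_le1].
  apply: le_trans (exprn_dist_le n (w0 x) (w0 y)) _.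
  rewrite -!mulrA ler_wpM2l// -[leRHS]mul1r; apply: ler_pM => //.
    by rewrite exprn_ge0// le_max w0.
  by apply: exprn_ile1; rewrite ?le_max ?w0// ge_max; case/andP: (w01 x) => _ ->; case/andP: (w01 y).
rewrite -[leRHS]mul1r; apply: ler_pM => //.
rewrite ger0_norm ?exprn_ge0//.
by apply: exprn_ile1 => //; case/andP: (w01 y).
Qed.

End ProductTestFunction.

(** * Cutoff functions and their local slopes *)

Section Cutoff.
Context {R : realType} {X : choiceType} (d : X -> X -> R).
Hypothesis dm : is_metric d.

Definition clamp01 (t : R) := Num.min 1 (Num.max 0 t).

Lemma clamp01_itv t : 0 <= clamp01 t <= 1.
Proof. by rewrite /clamp01 minEle maxEle; do ! case: ifPn; rewrite -?ltNge; lra. Qed.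

Lemma clamp01_lip s t : `|clamp01 s - clamp01 t| <= `|s - t|.
Proof.
have := ler_norm (s - t); have := ler_norm (t - s); rewrite (distrC t).
move: `|s - t| => k; rewrite ler_norml /clamp01 !minEle !maxEle.
by do ! case: ifPn; rewrite -?ltNge => *; apply/andP; split; lra.
Qed.

Lemma clamp01_eq1 t : 1 <= t -> clamp01 t = 1.
Proof. by move=> t1; rewrite /clamp01 max_r ?min_l//; lra. Qed.

Lemma clamp01_eq0 t : t <= 0 -> clamp01 t = 0.
Proof. by move=> t0; rewrite /clamp01 max_l ?min_r//; lra. Qed.

Lemma min_dist_le (a b c e k : R) : `|a - b| <= k -> `|c - e| <= k ->
  `|Num.min a c - Num.min b e| <= k.
Proof.
rewrite !ler_norml !minEle => /andP[? ?] /andP[? ?].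
by do ! case: ifPn; rewrite -?ltNge => *; apply/andP; split; lra.
Qed.

Variables (x0 : X) (R0 : R).
Hypothesis R0_gt0 : 0 < R0.

(* A ball [B(c, r)] of the cover is removed by a cutoff vanishing on [B(c, 2r)]
   and equal to 1 off [B(c, 3r)]. *)
Fixpoint cutoff (s : seq (X * R)) (x : X) : R :=
  if s is B :: s' then Num.min (clamp01 (d B.1 x / B.2 - 2)) (cutoff s' x)
  else clamp01 (2 - d x0 x / R0).

(** The cutoff of a ball varies only up to radius 3r; the open ball of radius 4r keeps the slope
    lower semicontinuous and leaves a margin r beyond which that cutoff is locally 1. A maximum, not
    a sum, matches the minimum in [cutoff], so at each point a single scale is active. *)
Fixpoint slope (s : seq (X * R)) (x : X) : R :=
  if s is B :: s' then
    (if d B.1 x < 4 * B.2 then Num.max B.2^-1 (slope s' x) else slope s' x)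
  else R0^-1.

Lemma cutoff_itv s x : 0 <= cutoff s x <= 1.
Proof.
elim: s => [|B s IH] /=; first exact: clamp01_itv.
by rewrite minEle; case: ifP => // _; exact: clamp01_itv.
Qed.

Lemma dist_diff_le c x y : `|d c x - d c y| <= d x y.
Proof.
have := dist_tri dm x c y; have := dist_tri dm y c x.
by rewrite (dist_sym dm y x) ler_norml; lra.
Qed.

Let scaled_lip r c x y : 0 < r -> `|d c x / r - d c y / r| <= r^-1 * d x y.
Proof.
move=> r0; rewrite -mulrBl normrM [`|r^-1|]gtr0_norm ?invr_gt0// mulrC.
by rewrite ler_wpM2l ?invr_ge0 ?(ltW r0)// dist_diff_le.
Qed.

Let phi_lip x y : `|clamp01 (2 - d x0 x / R0) - clamp01 (2 - d x0 y / R0)| <= R0^-1 * d x y.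
Proof.
apply: le_trans (clamp01_lip _ _) _; rewrite (_ : _ - _ = d x0 y / R0 - d x0 x / R0).
  by rewrite distrC scaled_lip.
by ring.
Qed.

Let eta_lip (B : X * R) x y : 0 < B.2 ->
  `|clamp01 (d B.1 x / B.2 - 2) - clamp01 (d B.1 y / B.2 - 2)| <= B.2^-1 * d x y.
Proof.
move=> r0; apply: le_trans (clamp01_lip _ _) _.
rewrite (_ : _ - _ = d B.1 x / B.2 - d B.1 y / B.2); first exact: scaled_lip.
by ring.
Qed.

Section Family.
Variable s : seq (X * R).
Hypothesis s_gt0 : forall B, B \in s -> 0 < B.2.

Lemma cutoff_lip : exists L, forall x y, `|cutoff s x - cutoff s y| <= L * d x y.
Proof.
elim: s s_gt0 => [|B t IH] t0 /=; first by exists R0^-1; exact: phi_lip.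
have [L HL] := IH (fun B' H => t0 B' (@mem_behead _ (B :: t) _ H)).
exists (Num.max B.2^-1 L) => x y; apply: min_dist_le.
  apply: le_trans (eta_lip x y (t0 B (mem_head _ _))) _.
  by rewrite ler_wpM2r ?dist_ge0// le_max lexx.
by apply: le_trans (HL x y) _; rewrite ler_wpM2r ?dist_ge0// le_max lexx orbT.
Qed.

Lemma slope_ge0 x : 0 <= slope s x.
Proof.
elim: s s_gt0 => [|B t IH] t0 /=; first by rewrite invr_ge0 ltW.
have IHt := IH (fun B' H => t0 B' (@mem_behead _ (B :: t) _ H)).
by case: ifP => // _; rewrite le_max IHt orbT.
Qed.

Lemma cutoff_slope_near x :
  near_pt d x [set y | `|cutoff s x - cutoff s y| <= slope s x * d x y /\
                       slope s x <= slope s y].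
Proof.
elim: s s_gt0 => [|B t IH] t0 /=.
  by apply: filterE => y; split => //; exact: phi_lip.
have IHt := IH (fun B' H => t0 B' (@mem_behead _ (B :: t) _ H)).
have B0 : 0 < B.2 by apply: t0; exact: mem_head.
case: ifPn => [xB|]; last rewrite -leNgt => xB.
  have oB : near_pt d x (oball d B.1 (4 * B.2)) by apply/near_ptP/mopen_oball.
  near=> y; have [H1 H2] : `|cutoff t x - cutoff t y| <= slope t x * d x y /\
                       slope t x <= slope t y by near: y.
  have /= yB : oball d B.1 (4 * B.2) y by near: y.
  split; last by rewrite yB ge_max !le_max lexx H2 orbT.
  apply: min_dist_le.
    apply: le_trans (eta_lip x y B0) _.
    by rewrite ler_wpM2r ?dist_ge0// le_max lexx.
  by apply: le_trans H1 _; rewrite ler_wpM2r ?dist_ge0// le_max lexx orbT.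
have oB : near_pt d x (oball d x B.2) by exists B.2.
near=> y; have [H1 H2] : `|cutoff t x - cutoff t y| <= slope t x * d x y /\
                       slope t x <= slope t y by near: y.
have yx : oball d x B.2 y by near: y.
have yB : 3 * B.2 <= d B.1 y.
  by move: yx xB; rewrite /oball /= => yx xB; have := dist_tri dm y B.1 x; rewrite (dist_sym dm y x); lra.
split; last by case: ifP => // _; rewrite le_max H2 orbT.
apply: min_dist_le => //; rewrite !clamp01_eq1; first last.
- have : 4 <= d B.1 x / B.2 by rewrite ler_pdivlMr.
  by lra.
- have : 3 <= d B.1 y / B.2 by rewrite ler_pdivlMr.
  by lra.
by rewrite subrr normr0; apply: le_trans H1.
Unshelve. all: by end_near. Qed.

Lemma slopeP x : slope s x = R0^-1 \/
  exists2 B, B \in s & slope s x = B.2^-1 /\ d B.1 x < 4 * B.2.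
Proof.
elim: s => [|B t IH] /=; first by left.
have {IH} [->|[B' B't [B'x B'd]]] : slope t x = R0^-1 \/
  exists2 B', B' \in B :: t & slope t x = B'.2^-1 /\ d B'.1 x < 4 * B'.2.
- by case: IH => [|[B' ? ?]]; [left | right; exists B'; rewrite // inE; apply/orP; right].
- case: ifP => xB; last by left.
  by rewrite maxEle; case: ifP => _; [left | right; exists B; [exact: mem_head | split]].
right; case: ifP => xB; last by exists B'; [exact: B't | split].
rewrite maxEle; case: ifP => _; first by exists B'; [exact: B't | split].
by exists B; [exact: mem_head | split].
Qed.

Lemma cutoff_eq0_ball B x : B \in s -> d B.1 x <= 2 * B.2 -> cutoff s x = 0.
Proof.
move=> + xB; elim: s s_gt0 => [//|B' t IH] t0 /=.
have t1 := fun B' H => t0 B' (@mem_behead _ (_ :: t) _ H).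
rewrite inE => /predU1P[BB|/(IH t1) ->].
  rewrite -BB; rewrite clamp01_eq0; first by rewrite min_l//; case/andP: (cutoff_itv t x).
  have B0 : 0 < B.2 by apply: t0; rewrite BB mem_head.
  have : d B.1 x / B.2 <= 2 by rewrite ler_pdivrMr.
  by lra.
by rewrite min_r//; case/andP: (clamp01_itv (d B'.1 x / B'.2 - 2)).
Qed.

Lemma cutoff_eq0_out x : 2 * R0 <= d x0 x -> cutoff s x = 0.
Proof.
move=> xR; elim: s => [|B t IH] /=.
  rewrite clamp01_eq0//; have : 2 <= d x0 x / R0 by rewrite ler_pdivlMr.
  by lra.
by rewrite IH min_r//; case/andP: (clamp01_itv (d B.1 x / B.2 - 2)).
Qed.

Lemma cutoff_eq1 x : d x0 x <= R0 -> (forall B, B \in s -> 3 * B.2 <= d B.1 x) ->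
  cutoff s x = 1.
Proof.
move=> xR; elim: s s_gt0 => [|B t IH] t0 H /=.
  rewrite clamp01_eq1//; have : d x0 x / R0 <= 1 by rewrite ler_pdivrMr// mul1r.
  by lra.
rewrite IH => [||B' B't]; last 2 first.
- by move=> B' B't; apply: t0; rewrite inE B't orbT.
- by apply: H; rewrite inE B't orbT.
rewrite min_r// clamp01_eq1//.
have : 3 <= d B.1 x / B.2 by rewrite ler_pdivlMr ?H ?t0 ?mem_head.
by lra.
Qed.

End Family.
End Cutoff.

(** * The Hardy inequality for the test function *)

Section StepIntegral.
Context {R : realType} {disp : measure_display} {X : measurableType disp}.
Variable (mu : {measure set X -> \bar R}).

Lemma integral_step_le (T : Type) (l : seq T) (c : T -> R) (A : T -> set X) (D : set X) :
  measurable D -> (forall i, 0 <= c i) -> (forall i, measurable (A i)) ->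
  (\int[mu]_(x in D) (\sum_(i <- l) c i * \1_(A i) x)%:E
    <= \sum_(i <- l) (c i)%:E * mu (A i))%E.
Proof.
move=> mD c0 mA; under eq_integral do rewrite -sumEFin.
rewrite ge0_integral_sum//.
- apply: lee_sum => i _; under eq_integral do rewrite EFinM.
  rewrite ge0_integralZl_EFin//; last first.
    by apply/measurable_EFinP/measurable_indic.
  rewrite lee_wpmul2l ?lee_fin// integral_indic//.
  by apply: le_measure; rewrite ?inE//; exact: measurableI.
- move=> i; apply/measurable_EFinP/measurable_funM => //.
- by move=> i x _; rewrite lee_fin mulr_ge0.
Qed.

Lemma measurable_step (T : Type) (l : seq T) (c : T -> R) (A : T -> set X) (D : set X) :
  (forall i, measurable (A i)) ->
  measurable_fun D (fun x => \sum_(i <- l) c i * \1_(A i) x).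
Proof.
move=> mA; apply: measurable_sum => i; apply: measurable_funM => //.
Qed.

End StepIntegral.

Section MainEstimate.
Context {R : realType} {disp : measure_display} {X : measurableType disp}.
Variables (d : X -> X -> R) (mu : {measure set X -> \bar R}) (Om : set X).
Variables (p beta CH Cd : R).
Hypothesis dm : is_metric d.
Hypothesis dc : metric_complete d.
Hypothesis dB : borel_wrt_metric d.
Hypothesis mu_ball : balls_pos_finite d mu.
Hypothesis dbl : doubling_with d mu Cd.
Hypothesis oOm : mopen d Om.
Hypothesis hardy : hardy_with d mu Om p beta CH.
Hypotheses (p1 : 1 <= p) (bp_lt : beta < p).

Variables (b th : R) (n : nat).
Hypotheses (b0 : 0 < b) (th0 : 0 < th).
Hypothesis absorb : ((2 * n.+1%:R * th) `^ p + (2 * b) `^ p) * CH <= 2^-1.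
Hypothesis n_large : `|beta| + b * p <= n%:R * p.

(** The coefficient in [gradient_term] for q = p - beta, where p - q + a becomes beta + a; it
    involves neither the cutoff nor rho. *)
Definition grad_const (a : R) : R :=
  (2 * n.+1%:R) `^ p * (5 `^ (beta + a) + th `^ (beta + a)).

Variables (x0 : X) (R0 rho : R) (s : seq (X * R)).
Hypotheses (Ex0 : ~ Om x0) (R0_gt0 : 0 < R0) (rho0 : 0 < rho).
Hypothesis s_gt0 : forall B, B \in s -> 0 < B.2.
Hypothesis s_cover : forall y, ~ Om y -> d x0 y <= 2 * R0 ->
  exists2 B, B \in s & d B.1 y < 2 * B.2.
Hypothesis s_near : forall B, B \in s -> exists y, ~ Om y /\ d B.1 y <= B.2.
Hypothesis s_small : forall B, B \in s -> 5 * B.2 <= rho.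

Local Notation dist := (dOm d Om).
Local Notation w := (cutoff d x0 R0 s).
(** A closed bounded set containing the support of the test function. It misses the complement of
    [Om], since the open balls of doubled radius cover that complement near [x0]. *)
Let K := [set x | d x0 x <= 2 * R0 /\ forall B, B \in s -> 2 * B.2 <= d B.1 x].

Let p0 : 0 <= p. Proof. exact: le_trans p1. Qed.

Let CH0 : 0 < CH. Proof. by case: hardy. Qed.

Let bp0 : 0 < b * p. Proof. by rewrite mulr_gt0// (lt_le_trans _ p1). Qed.

Let n_gt0 : (0 < n)%N.
Proof.
rewrite lt0n; apply/eqP => n0; move: n_large; rewrite n0 mul0r.
by move: bp0; have := normr_ge0 beta; lra.
Qed.

Let w_itv x : 0 <= w x <= 1. Proof. exact: cutoff_itv. Qed.

Let w_neq0 x : w x != 0 -> K x.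
Proof.
move=> /eqP wx; split=> [|B Bs].
  by rewrite leNgt; apply/negP => /ltW/(cutoff_eq0_out (d := d) (x0 := x0) R0_gt0 s (x := x))/wx.
by rewrite leNgt; apply/negP => /ltW/(cutoff_eq0_ball x0 R0 s_gt0 Bs)/wx.
Qed.

Let closed_K : mopen d (~` K).
Proof.
move=> x /= /not_andP[/negP|/existsNP[B /not_implyP[Bs /negP]]]; rewrite -ltNge => h.
  have oC : mopen d (~` cball d x0 (2 * R0)) by exact: mopenC_cball.
  have [|r [r0 rh]] := oC x; first by apply/negP; rewrite -ltNge.
  by exists r; split=> // y /rh /= ? [].
have [r [r0 rh]] : exists r, 0 < r /\ oball d x r `<=` oball d B.1 (2 * B.2).
  exact: mopen_oball.
by exists r; split=> // y /rh; rewrite /oball /= ltNge => /negP h' [_ /(_ B Bs)].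
Qed.

Let K_Om : K `<=` Om.
Proof.
move=> x [xR xB]; apply: contrapT => /s_cover -/(_ xR)[B /xB].
by rewrite leNgt => /negP.
Qed.

Let near_dist B x : B \in s -> dist x <= d B.1 x + B.2.
Proof.
move=> /s_near[y [Ey yB]]; apply: le_trans (dOm_le dm Ex0 x Ey) _.
by apply: le_trans (dist_tri dm B.1 _ _) _; rewrite (dist_sym dm x) lerD2l.
Qed.

Let dist_gt0 x : Om x -> 0 < dist x. Proof. exact: (dOm_gt0 dm oOm Ex0). Qed.

Lemma measurable_dOm : measurable_fun setT (dist : X -> R).
Proof.
by apply: (measurable_lip dm dB (L := 1)) => x y; rewrite mul1r (dOm_lip dm Ex0).
Qed.

Let mOm : measurable Om. Proof. exact: (measurable_mopen dB). Qed.

Definition annulus (r : R) := [set x | d x0 x <= R0 /\ rho < dist x <= r].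

Lemma measurable_annulus r : measurable (annulus r).
Proof.
rewrite (_ : annulus r = cball d x0 R0 `&` (setT `&` dist @^-1` `]rho, r])).
  apply: measurableI; first exact: (measurable_cball dm dB).
  by apply: measurable_dOm => //; exact: measurable_itv.
by apply/seteqP; split=> x; rewrite /annulus /cball /= in_itv /=; tauto.
Qed.

Let S := \sum_(B <- s) grad_const (b * p) * rho `^ (- (b * p)) *
   B.2 `^ (b * p - (p - beta)) * vol d mu B.1 (4 * B.2).
Let S0 := grad_const (- (b * p)) * rho `^ (b * p) *
   R0 `^ (- (b * p) - (p - beta)) * vol d mu x0 (2 * R0).

Section Delta.
Variable dl : R.
Hypotheses (dl0 : 0 < dl) (K_dl : forall x, K x -> dl <= dist x).

(** Truncation keeps the tent of the distance Lipschitz on all of X; on [K] nothing changes. *)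
Let D x := Num.max dl (dist x).
Let u := test_fun w D b rho n.
Let g := test_grad w D (slope d R0 s) b rho n.

Let DK x : K x -> D x = dist x.
Proof. by move=> /K_dl h; rewrite /D max_r. Qed.

Let D_lip x y : `|D x - D y| <= d x y.
Proof.
rewrite /D; apply: le_trans (dOm_lip dm Ex0 x y).
have := ler_norm (dist x - dist y); have := ler_norm (dist y - dist x).
rewrite (distrC (dist y)); have := normr_ge0 (dist x - dist y).
move: `|_ - _| => k; rewrite ler_norml !maxEle.
by do ! case: ifPn; rewrite -?ltNge => *; apply/andP; split; lra.
Qed.

Let D_ge x : dl <= D x. Proof. by rewrite le_max lexx. Qed.

Let u_ug : upper_gradient d u g.
Proof.
have [L HL] := cutoff_lip dm x0 R0_gt0 s_gt0.
apply: (test_fun_upper_gradient dm dB rho n w_itv HL D_lip dl0 D_ge) => //.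
- exact: slope_ge0.
- move=> x; have := cutoff_slope_near dm x0 R0_gt0 s_gt0 x.
  by apply: filterS => y [].
- move=> x; have := cutoff_slope_near dm x0 R0_gt0 s_gt0 x.
  by apply: filterS => y [].
Qed.

Let u_lip : Defs.lipschitz d u.
Proof.
have [L HL] := cutoff_lip dm x0 R0_gt0 s_gt0.
exact: (test_fun_lipschitz dm rho n w_itv HL D_lip dl0 D_ge b0).
Qed.

Let supp_K : Defs.support d u `<=` K.
Proof.
apply: mclosure_sub => // x /=; rewrite /u /test_fun => ux; apply: w_neq0.
by apply: contra ux => /eqP ->; rewrite expr0n mul0r.
Qed.

Let supp_compact : mcompact d (Defs.support d u).
Proof.
apply: (mcompact_cball dm dB mu_ball dbl dc (x := x0) (r := 2 * R0)).
  exact: mopenC_mclosure.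
by move=> x /supp_K[].
Qed.

Let u_ge0 x : 0 <= u x.
Proof.
by rewrite mulr_ge0 ?exprn_ge0 ?(ltW (tent_gt0 _ _ _))//; case/andP: (w_itv x).
Qed.

Let U x := u x `^ p * dist x `^ (beta - p).
Let G x := grad_const (- (b * p)) * rho `^ (b * p) *
   R0 `^ (- (b * p) - (p - beta)) * \1_(cball d x0 (2 * R0)) x +
  \sum_(B <- s) grad_const (b * p) * rho `^ (- (b * p)) *
   B.2 `^ (b * p - (p - beta)) * \1_(cball d B.1 (4 * B.2)) x.

(** Only one scale is active at x. If it is [R0], the decreasing branch of the tent is used (a = -
    bp), and if it is the radius of a cover ball, the increasing one (a = bp). Where the cutoff
    vanishes so does the gradient, because n > 0. *)
Let pointwise x : Om x ->
  g x `^ p * dist x `^ beta <=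
  ((2 * n.+1%:R * th) `^ p + (2 * b) `^ p) * U x + G x.
Proof.
move=> Ox; have G1 : 0 <= \sum_(B <- s) grad_const (b * p) * rho `^ (- (b * p)) *
   B.2 `^ (b * p - (p - beta)) * \1_(cball d B.1 (4 * B.2)) x.
  by apply: sumr_ge0 => B _; rewrite !mulr_ge0 ?addr_ge0 ?powR_ge0 ?indicE ?ler0n.
have G0 : 0 <= grad_const (- (b * p)) * rho `^ (b * p) *
   R0 `^ (- (b * p) - (p - beta)) * \1_(cball d x0 (2 * R0)) x.
  by rewrite !mulr_ge0 ?addr_ge0 ?powR_ge0 ?indicE ?ler0n.
have [wx|wx] := eqVneq (w x) 0.
  rewrite /g /test_grad wx !expr0n -[n in (n == _)%N]prednK//= !(mulr0, mul0r) addr0.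
  rewrite powR0 ?mul0r; last by rewrite gt_eqF// (lt_le_trans _ p1).
  rewrite addr_ge0 ?mulr_ge0 ?addr_ge0 ?powR_ge0//.
have Kx := w_neq0 wx; have dx := dist_gt0 Ox.
have T1 := (tent_powR b0 rho0 p0 dx).1; have T2 := (tent_powR b0 rho0 p0 dx).2.
have t0 := ltW (tent_gt0 b rho (dist x)).
have [nb1 nb2] : - beta <= `|beta| /\ beta <= `|beta|.
  by split; rewrite ?ler_norm// -normrN ler_norm.
have UE : (w x ^+ n.+1 * tent b rho (dist x)) `^ p * dist x `^ (- (p - beta)) = U x.
  by rewrite /U /u /test_fun DK// opprB.
rewrite /g /test_grad DK//.
case: (slopeP d R0 s x) => [->|[B Bs [-> xB]]].
  have xs : dist x <= 5 * R0.
    apply: le_trans (dOm_le dm Ex0 x Ex0) _; rewrite (dist_sym dm).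
    by apply: le_trans (Kx.1) _; move: R0_gt0; lra.
  have ne : 0 <= p - (p - beta) + - (b * p) + n%:R * p.
    by rewrite subKr; move: n_large; lra.
  have := gradient_term p1 th0 R0_gt0 dx xs (w_itv x) t0 (powR_ge0 _ _) b0 T1 ne.
  rewrite UE subKr => H; apply: le_trans H _.
  rewrite lerD2l /G ler_wpDr//.
  rewrite indicE mem_set ?mulr1; last exact: Kx.1.
  rewrite /grad_const le_eqVlt; apply/orP; left; apply/eqP; ring.
(* Origin of the 5: x is within 4r of the centre, and the centre within r of the complement. *)
have xs : dist x <= 5 * B.2.
  by apply: le_trans (near_dist x Bs) _; move: xB (s_gt0 Bs); lra.
have ne : 0 <= p - (p - beta) + b * p + n%:R * p.
  by rewrite subKr; move: n_large bp0; lra.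
have := gradient_term p1 th0 (s_gt0 Bs) dx xs (w_itv x) t0 (powR_ge0 _ _) b0 T2 ne.
rewrite UE subKr => H; apply: le_trans H _.
rewrite lerD2l /G ler_wpDl// (big_rem _ Bs)/= ler_wpDr//.
  by apply: sumr_ge0 => B' _; rewrite !mulr_ge0 ?addr_ge0 ?powR_ge0 ?indicE ?ler0n.
rewrite indicE mem_set ?mulr1; last exact: ltW.
by rewrite /grad_const le_eqVlt; apply/orP; left; apply/eqP; ring.
Qed.

Let U_ge0 x : 0 <= U x. Proof. by rewrite mulr_ge0 ?powR_ge0. Qed.

Let measurable_powR_comp (f : X -> R) e : measurable_fun setT f ->
  measurable_fun setT (fun x => f x `^ e).
Proof. by move=> mf; exact: (measurableT_comp (measurable_powR e) mf). Qed.

Let mU : measurable_fun setT U.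
Proof.
have [L HL] := u_lip.
apply: measurable_funM; apply: measurable_powR_comp; last exact: measurable_dOm.
exact: (measurable_lip dm dB HL).
Qed.

Let mG : measurable_fun setT G.
Proof.
apply: measurable_funD.
  by apply: measurable_funM => //; apply/measurable_indic/(measurable_cball dm dB).
by apply: measurable_step => B; exact: (measurable_cball dm dB).
Qed.

Let G_ge0 x : 0 <= G x.
Proof.
apply: addr_ge0; first by rewrite !mulr_ge0 ?addr_ge0 ?powR_ge0 ?indicE ?ler0n.
by apply: sumr_ge0 => B _; rewrite !mulr_ge0 ?addr_ge0 ?powR_ge0 ?indicE ?ler0n.
Qed.

Let intG : (\int[mu]_(x in Om) (G x)%:E <= (S0 + S)%:E)%E.
Proof.
have sub (f : X -> R) : measurable_fun setT f -> measurable_fun Om f.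
  by move=> mf; exact: (measurable_funS measurableT).
rewrite /G; under eq_integral do rewrite EFinD.
rewrite ge0_integralD//; first last.
- apply/measurable_EFinP/sub/measurable_step => B; exact: (measurable_cball dm dB).
- move=> x _; rewrite lee_fin.
  by apply: sumr_ge0 => B _; rewrite !mulr_ge0 ?addr_ge0 ?powR_ge0 ?indicE ?ler0n.
- apply/measurable_EFinP/sub/measurable_funM => //.
  exact/measurable_indic/(measurable_cball dm dB).
- by move=> x _; rewrite lee_fin !mulr_ge0 ?addr_ge0 ?powR_ge0 ?indicE ?ler0n.
rewrite EFinD; apply: leeD.
  have := integral_step_le mu [:: tt] (c := fun=> grad_const (- (b * p)) * rho `^ (b * p) *
    R0 `^ (- (b * p) - (p - beta))) (A := fun=> cball d x0 (2 * R0)) mOm.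
  rewrite big_seq1; under eq_integral do rewrite big_seq1.
  rewrite (volE dm dB mu_ball) -EFinM; apply=> _; last exact: (measurable_cball dm dB).
  by rewrite !mulr_ge0 ?addr_ge0 ?powR_ge0.
apply: le_trans (integral_step_le mu s (c := fun B => grad_const (b * p) * rho `^ (- (b * p)) *
   B.2 `^ (b * p - (p - beta))) (A := fun B => cball d B.1 (4 * B.2)) mOm _ _) _.
- by move=> B; rewrite !mulr_ge0 ?addr_ge0 ?powR_ge0.
- by move=> B; exact: (measurable_cball dm dB).
rewrite /S -sumEFin; apply: lee_sum => B _.
by rewrite (volE dm dB mu_ball) -EFinM.
Qed.

Let U_bound x : Om x -> U x <= dl `^ (beta - p) * \1_(cball d x0 (2 * R0)) x.
Proof.
move=> Ox; have [wx|wx] := eqVneq (w x) 0.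
  rewrite /U /u /test_fun wx expr0n mul0r powR0 ?mul0r ?mulr_ge0 ?powR_ge0 ?indicE ?ler0n//.
  by rewrite gt_eqF// (lt_le_trans _ p1).
have Kx := w_neq0 wx; rewrite indicE mem_set ?mulr1; last exact: Kx.1.
rewrite -[leRHS]mul1r; apply: ler_pM; rewrite ?powR_ge0//.
  apply: (@le_trans _ _ (1 `^ p)); last by rewrite powR1.
  apply: ge0_le_powR => //; have /andP[w0 w1] := w_itv x.
  rewrite /u /test_fun -[leRHS]mul1r; apply: ler_pM; rewrite ?exprn_ge0 ?exprn_ile1 ?tent_le1//.
  exact/ltW/tent_gt0.
by apply: le0_ger_powR; rewrite ?K_dl// subr_le0 ltW.
Qed.

(** Compact support bounds the integrand by a power of [dl], so the integral is finite and half of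
    it can be subtracted in v <= CH (k v + S0 + S), where k CH <= 1/2. The final bound is free of
    [dl]. *)
Let int_U : exists2 v : R, (\int[mu]_(x in Om) (U x)%:E = v%:E)%E &
  v <= 2 * CH * (S0 + S).
Proof.
have sub (f : X -> R) : measurable_fun setT f -> measurable_fun Om (EFin \o f).
  by move=> mf; apply/measurable_EFinP/(measurable_funS measurableT).
have I0 : (0 <= \int[mu]_(x in Om) (U x)%:E)%E.
  by apply: integral_ge0 => x _; rewrite lee_fin.
have fI : (\int[mu]_(x in Om) (U x)%:E < +oo)%E.
  apply: (@le_lt_trans _ _ (\int[mu]_(x in Om)
     (\sum_(i <- [:: tt]) dl `^ (beta - p) * \1_(cball d x0 (2 * R0)) x)%:E)%E).
    apply: ge0_le_integral => //; try exact: sub.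
    - by move=> x _; rewrite lee_fin.
    - by apply/sub/measurable_step => _; exact: (measurable_cball dm dB).
    - by move=> x Ox; rewrite big_seq1 lee_fin; exact: U_bound.
  apply: le_lt_trans (integral_step_le mu [:: tt] (c := fun=> _) (A := fun=> _) mOm _ _) _.
  - by move=> _; exact: powR_ge0.
  - by move=> _; exact: (measurable_cball dm dB).
  - by rewrite big_seq1 (volE dm dB mu_ball) -EFinM ltry.
have fin : (\int[mu]_(x in Om) (U x)%:E)%E \is a fin_num by rewrite ge0_fin_numE.
exists (fine (\int[mu]_(x in Om) (U x)%:E)%E); first by rewrite fineK.
set v := fine _; have vE : (\int[mu]_(x in Om) (U x)%:E = v%:E)%E by rewrite fineK.
have v0 : 0 <= v by rewrite -lee_fin -vE.
have [_ /(_ u u_lip supp_compact (subset_trans supp_K K_Om) g u_ug)] := hardy.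
have -> : (\int[mu]_(x in Om) (`|u x| `^ p * dist x `^ (beta - p))%:E = v%:E)%E.
  by rewrite -vE; apply: eq_integral => x _; rewrite ger0_norm.
set k := (2 * n.+1%:R * th) `^ p + (2 * b) `^ p.
have k0 : 0 <= k by rewrite addr_ge0 ?powR_ge0.
have J : (\int[mu]_(x in Om) (g x `^ p * dist x `^ beta)%:E <= (k * v + (S0 + S))%:E)%E.
  apply: (@le_trans _ _ (\int[mu]_(x in Om) ((k * U x)%:E + (G x)%:E))%E).
    apply: ge0_le_integral => //.
    - by move=> x _; rewrite lee_fin mulr_ge0 ?powR_ge0.
    - apply: sub; apply: measurable_funM; apply: measurable_powR_comp.
        by case: u_ug.
      exact: measurable_dOm.
    - by apply: emeasurable_funD; apply: sub => //; exact: measurable_funM.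
  rewrite ge0_integralD//.
  - rewrite EFinD; apply: leeD; last exact: intG.
    under eq_integral do rewrite EFinM.
    by rewrite ge0_integralZl_EFin ?vE//; [move=> x _; rewrite lee_fin | exact: sub].
  - by move=> x _; rewrite lee_fin mulr_ge0.
  - by apply: sub; exact: measurable_funM.
  - by move=> x _; rewrite lee_fin.
  - exact: sub.
move=> H; have {H J} : v <= CH * (k * v + (S0 + S)).
  rewrite -lee_fin; apply: le_trans H _; rewrite EFinM.
  by apply: lee_wpmul2l J; rewrite lee_fin ltW.
have : (k * CH) * v <= 2^-1 * v by rewrite ler_wpM2r.
by lra.
Qed.

(** On the annulus the cutoff is 1, and both the tent beyond its peak and the weight, of negative
    exponent, are smallest at distance r. *)
Lemma annulus_estimate_aux r : 0 < r ->
  rho `^ (b * p) * r `^ (- (b * p)) * r `^ (beta - p) * fine (mu (annulus r)) <=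
  2 * CH * (S0 + S).
Proof.
move=> r0; have [v vE vS] := int_U; apply: le_trans vS.
have mA := measurable_annulus r.
have muA : mu (annulus r) \is a fin_num.
  rewrite ge0_fin_numE//; apply: (@le_lt_trans _ _ (mu (cball d x0 R0))).
    by apply: le_measure; rewrite ?inE//; [exact: (measurable_cball dm dB) | move=> x []].
  by rewrite (volE dm dB mu_ball) ltry.
have A_Om : annulus r `<=` Om.
  by move=> x [_ /andP[rx _]]; apply/(dOm_gt0P dm oOm Ex0)/(lt_trans rho0).
rewrite -lee_fin -vE EFinM fineK//.
set k := _ * _ * _.
rewrite -(integral_cst mu mA k%:E).
apply: (@le_trans _ _ (\int[mu]_(x in annulus r) (U x)%:E)%E); last first.
  apply: ge0_subset_integral => //.
  - by apply/measurable_EFinP/(measurable_funS measurableT).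
  - by move=> x _; rewrite lee_fin.
apply: ge0_le_integral => //.
- by move=> x _; rewrite lee_fin !mulr_ge0 ?powR_ge0.
- by apply/measurable_EFinP/(measurable_funS measurableT).
move=> x [xR /andP[rx xr]]; rewrite lee_fin /U /k.
have wx : w x = 1.
  (* The distance exceeds rho >= 5r and is at most d(c, x) + r, so x is farther than 4r from c. *)
  apply: (cutoff_eq1 R0_gt0 s_gt0) => // B Bs.
  by move: rx (near_dist x Bs) (s_small Bs) (s_gt0 Bs); lra.
have Kx : K x by apply: w_neq0; rewrite wx oner_neq0.
apply: ler_pM; rewrite ?mulr_ge0 ?powR_ge0//.
  rewrite /u /test_fun wx expr1n mul1r DK//.
  by apply: tent_powR_ge => //; exact: ltW.
by apply: le0_ger_powR => //; [rewrite subr_le0 ltW | exact: lt_trans rx].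
Qed.

End Delta.

Lemma annulus_estimate r : 0 < r ->
  rho `^ (b * p) * r `^ (- (b * p)) * r `^ (beta - p) * fine (mu (annulus r)) <=
  2 * CH * (grad_const (- (b * p)) * rho `^ (b * p) *
   R0 `^ (- (b * p) - (p - beta)) * vol d mu x0 (2 * R0) +
   \sum_(B <- s) grad_const (b * p) * rho `^ (- (b * p)) *
   B.2 `^ (b * p - (p - beta)) * vol d mu B.1 (4 * B.2)).
Proof.
have cK : mcompact d K.
  by apply: (mcompact_cball dm dB mu_ball dbl dc closed_K) => x [xR _]; exact: xR.
have [dl [dl0 Kdl]] := dOm_compact_gt0 dm oOm Ex0 cK K_Om.
exact: (annulus_estimate_aux dl0 Kdl).
Qed.

End MainEstimate.

(** * Covers of small content *)

Section ContentCover.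
Context {R : realType} {disp : measure_display} {X : measurableType disp}.
Variables (d : X -> X -> R) (mu : {measure set X -> \bar R}) (Om : set X).
Variables (Cd : R).
Hypothesis dm : is_metric d.
Hypothesis dc : metric_complete d.
Hypothesis dB : borel_wrt_metric d.
Hypothesis mu_ball : balls_pos_finite d mu.
Hypothesis dbl : doubling_with d mu Cd.
Hypothesis oOm : mopen d Om.

Lemma mcompact_boundary x r : mcompact d (~` Om `&` cball d x r).
Proof.
apply: (mcompact_cball dm dB mu_ball dbl dc (x := x) (r := r)); last by move=> y [].
move=> y /= /not_andP[/contrapT/oOm|].
  by move=> [s [s0 sO]]; exists s; split=> // z /sO Oz [].
by move=> /(mopenC_cball dm)[s [s0 sO]]; exists s; split=> // z /sO Oz [].
Qed.

(** Radii are at most 1, so each term of a cover grows with the exponent. *)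
Lemma hcontent_le q q' : q <= q' ->
  (hcontent d mu q 1 (~` Om) <= hcontent d mu q' 1 (~` Om))%E.
Proof.
move=> qq; apply: le_ereal_inf_tmp => _ [c [r [rr cov ->]]].
apply: (@le_trans _ _ (\sum_(0 <= k <oo) ((r k `^ (- q))%:E * mu (cball d (c k) (r k))))%E).
  by apply: ereal_inf_lbound; exists c, r.
apply: lee_nneseries => k _; first by rewrite mule_ge0// lee_fin powR_ge0.
have [r0 r1] := rr k.
rewrite lee_wpmul2r// lee_fin !powR_expR// ler_expR ler_wnM2r ?ln_le0//.
by rewrite lerN2.
Qed.

Lemma hcontent_ge0 q Rr : (0 <= hcontent d mu q Rr (~` Om))%E.
Proof.
apply: le_ereal_inf_tmp => _ [c [r [_ _ ->]]].
by apply: nneseries_ge0 => k _ _; rewrite mule_ge0// lee_fin powR_ge0.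
Qed.

(** Zero content at scale 1 already forces small radii: a large ball meeting the complement near
    [x0] would alone contribute a definite amount to the sum. Compactness then leaves finitely many
    balls, doubled in radius to be open, and two doublings bound the 4r balls. *)
Lemma content_cover q x0 R0 rho e : 0 <= q -> hcontent d mu q 1 (~` Om) = 0%E ->
  0 < R0 -> 0 < rho -> 0 < e ->
  exists s : seq (X * R),
    [/\ forall B, B \in s -> 0 < B.2,
        forall y, ~ Om y -> d x0 y <= 2 * R0 -> exists2 B, B \in s & d B.1 y < 2 * B.2,
        forall B, B \in s -> exists y, ~ Om y /\ d B.1 y <= B.2,
        forall B, B \in s -> 5 * B.2 <= rho &
        \sum_(B <- s) B.2 `^ (- q) * vol d mu B.1 (4 * B.2) <= e].
Proof.
move=> q0 H0 R00 rho0 e0.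
pose ka := Num.min (rho / 5) 1.
have ka0 : 0 < ka by rewrite lt_min ltr01 andbT; lra.
have [C [C0 HC]] := vol_comparable dm dB mu_ball dbl (2 * R0 + 1) ka0.
(* A lower bound for the contribution of any ball of radius in [ka, 1] that meets the relevant part
   of the complement, as r^(-q) >= 1 there. *)
pose m := vol d mu x0 (2 * R0 + 1) / C.
have m0 : 0 < m by rewrite divr_gt0// (vol_gt0 dm dB mu_ball)//; lra.
have Cd0 : 0 < Cd by apply: lt_le_trans (doubling_ge1 dm dB mu_ball dbl).
pose e' := Num.min m (e / Cd ^+ 2).
have e'0 : 0 < e' by rewrite lt_min m0 divr_gt0// exprn_gt0.
have [v [c [r [rr cov vE]]]] : exists2 v : \bar R, exists (c : nat -> X) (r : nat -> R),
    [/\ forall k, 0 < r k /\ r k <= 1, ~` Om `<=` \bigcup_k cball d (c k) (r k) &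
    v = (\sum_(0 <= k <oo) ((r k `^ (- q))%:E * mu (cball d (c k) (r k))))%E] & (v < e'%:E)%E.
  by apply: ereal_inf_lt; rewrite -/(hcontent d mu q 1 (~` Om)) H0 lte_fin.
move=> ve.
pose a k := r k `^ (- q) * vol d mu (c k) (r k).
have vol0 k : 0 < vol d mu (c k) (r k) by apply: (vol_gt0 dm dB mu_ball); case: (rr k).
have a0 k : 0 <= a k by rewrite mulr_ge0 ?powR_ge0// ltW.
have partial N : \sum_(0 <= k < N) a k < e'.
  rewrite -lte_fin; apply: le_lt_trans ve; rewrite -sumEFin vE.
  rewrite (eq_bigr (fun k => (r k `^ (- q))%:E * mu (cball d (c k) (r k)))%E).
    by apply: nneseries_lim_ge => k _ _; rewrite mule_ge0// lee_fin powR_ge0.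
  by move=> k _; rewrite (volE dm dB mu_ball) EFinM.
pose hits k := exists y, [/\ ~ Om y, d x0 y <= 2 * R0 & d (c k) y <= r k].
have small k : hits k -> r k <= ka.
  move=> [y [Ey y1 y2]]; rewrite leNgt; apply/negP => kr.
  have : a k < m.
    apply: le_lt_trans (lt_le_trans (partial k.+1) _); last by rewrite ge_min lexx.
    by rewrite big_nat_recr//= lerDr sumr_ge0.
  have [r0 r1] := rr k.
  apply/negP; rewrite -leNgt /m ler_pdivrMr// [leRHS]mulrC.
  apply: le_trans (HC x0 (c k) _) _.
    by have := dist_tri dm y x0 (c k); rewrite (dist_sym dm y (c k)); lra.
  apply: ler_wpM2l; first exact: ltW.
  apply: (@le_trans _ _ (1 * vol d mu (c k) (r k))).
    by rewrite mul1r; apply: (vol_le dm dB mu_ball); rewrite distxx// add0r ltW.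
  apply: ler_wpM2r; first exact: ltW.
  by rewrite powR_expR// -expR0 ler_expR mulr_le0 ?ln_le0// oppr_le0.
pose F k := [set y | hits k /\ d (c k) y < 2 * r k].
have [k y [hk yk]|y [Ey yR]|J [fJ HJ]] := (@mcompact_boundary x0 (2 * R0) nat F).
- have [t [t0 tF]] : exists t, 0 < t /\ oball d y t `<=` oball d (c k) (2 * r k).
    exact: mopen_oball.
  by exists t; split=> // z /tF.
- have [k _ yk] := cov y Ey; exists k => //; split; first by exists y.
  by move: yk; have [r0 _] := rr k; rewrite /cball /=; lra.
have [sJ JE] : exists s : seq nat, J = [set` s] by apply/finite_seqP.
(* All hitting indices below N replace the finite subcover, so that the sum is dominated by a
   partial sum of the series. *)
pose N := (\max_(i <- sJ) i).+1.
pose l := [seq k <- iota 0 N | `[< hits k >]].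
exists [seq (c k, r k) | k <- l].
have lP B : B \in [seq (c k, r k) | k <- l] -> exists2 k, hits k & B = (c k, r k).
  by move=> /mapP[k]; rewrite mem_filter => /andP[/asboolP hk _] ->; exists k.
split.
- by move=> B /lP[k _ ->] /=; case: (rr k).
- move=> y Ey yR; have [k Jk [hk yk]] := HJ y (conj Ey yR).
  exists (c k, r k) => //; apply/mapP; exists k => //.
  rewrite mem_filter mem_iota; apply/andP; split; first exact/asboolP.
  rewrite /= add0n ltnS; apply: leq_bigmax_seq => //.
  by move: Jk; rewrite JE.
- by move=> B /lP[k [y [Ey _ yk]] ->]; exists y.
- move=> B /lP[k /small rk ->] /=.
  by apply: le_trans (ler_wpM2l _ rk) _ => //; have : ka <= rho / 5 by [rewrite ge_min lexx]; lra.
rewrite big_map big_filter big_mkcond /=.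
apply: (@le_trans _ _ (\sum_(k <- iota 0 N) Cd ^+ 2 * a k)).
  apply: ler_sum => k _; case: ifP => _; last by rewrite mulr_ge0// exprn_ge0// ltW.
  rewrite /a mulrCA; apply: ler_wpM2l; first exact: powR_ge0.
  have := vol_double_iter dm dB mu_ball dbl (c k) 2 (rr k).1.
  by rewrite (_ : 2 ^+ 2 = 4 :> R)// expr2; lra.
rewrite -mulr_sumr mulrC -ler_pdivlMr ?exprn_gt0//.
have := partial N; rewrite /index_iota subn0 => /ltW h; apply: le_trans h _.
by rewrite ge_min lexx orbT.
Qed.

End ContentCover.

(** * Codimensions *)

Section Codimension.
Context {R : realType} {disp : measure_display} {X : measurableType disp}.
Variables (d : X -> X -> R) (mu : {measure set X -> \bar R}) (Om : set X).
Variables (p beta CH Cd : R).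
Hypothesis dm : is_metric d.
Hypothesis dc : metric_complete d.
Hypothesis dB : borel_wrt_metric d.
Hypothesis mu_ball : balls_pos_finite d mu.
Hypothesis dbl : doubling_with d mu Cd.
Hypothesis oOm : mopen d Om.

Lemma measurable_nbhd_set x r : ~ Om x -> measurable (nbhd_set d (~` Om) r).
Proof.
move=> Ex; rewrite (_ : nbhd_set _ _ _ = setT `&` dOm d Om @^-1` `]-oo, r[).
  by apply: (measurable_dOm dm dB Ex) => //; exact: measurable_itv.
by apply/seteqP; split=> y; rewrite /nbhd_set /= (edistE dm Ex) lte_fin in_itv //=; case.
Qed.

Lemma lower_assouad_codim_ge0 : (0 <= lower_assouad_codim d mu (~` Om))%E.
Proof.
apply: ereal_sup_ubound; exists 0 => //; split=> //; exists 1; split=> //.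
move=> x r Rr Ex r0 rR _; rewrite powRr0 mulr1 mul1e.
apply: le_measure; rewrite ?inE; [|exact: (measurable_cball dm dB)|by move=> y []].
by apply: measurableI; [exact: measurable_nbhd_set Ex | exact: (measurable_cball dm dB)].
Qed.

Lemma lower_assouad_codim_empty : ~` Om = set0 ->
  lower_assouad_codim d mu (~` Om) = +oo%E.
Proof.
move=> ->; apply/eqyP => t t0; apply: ereal_sup_ubound.
exists t => //; split; first exact: ltW.
by exists 1; split=> // x r Rr [].
Qed.

Hypothesis hardy : hardy_with d mu Om p beta CH.
Hypotheses (p1 : 1 <= p) (bp_lt : beta < p).

Variables (b th : R) (n : nat).
Hypotheses (b0 : 0 < b) (th0 : 0 < th).
Hypothesis absorb : ((2 * n.+1%:R * th) `^ p + (2 * b) `^ p) * CH <= 2^-1.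
Hypothesis n_large : `|beta| + b * p <= n%:R * p.
Hypothesis b_le : b * p <= p - beta.
Hypothesis content0 : hcontent d mu (p - beta - b * p) 1 (~` Om) = 0%E.

Let CH0 : 0 < CH. Proof. by case: hardy. Qed.

(* The content of the boundary vanishes, so the cover term of
   [annulus_estimate] can be made arbitrarily small for fixed [rho]. *)
Lemma annulus_bound x0 R0 rho r : ~ Om x0 -> 0 < R0 -> 0 < rho -> 0 < r ->
  fine (mu (annulus d Om x0 R0 rho r)) <=
  2 * CH * grad_const p beta th n (- (b * p)) * Cd *
  (r / R0) `^ (p - beta + b * p) * vol d mu x0 R0.
Proof.
move=> Ex0 R00 rho0 r0; set A := fine _; set gc := grad_const _ _ _ _ _.
move: b_le content0; set q := p - beta => bq H0.
have rb0 := powR_gt0 (b * p) rho0.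
have rN0 := powR_gt0 (- (b * p)) rho0.
have v2 := vol_double dm dB mu_ball dbl x0 R00.
have k0 : 0 < r `^ (- (q + b * p)) by exact: powR_gt0.
suff H : r `^ (- (q + b * p)) * A <=
    2 * CH * gc * R0 `^ (- (q + b * p)) * vol d mu x0 (2 * R0).
  have rR : (r / R0) `^ (q + b * p) = (r `^ (- (q + b * p)))^-1 * R0 `^ (- (q + b * p)).
    rewrite powRM ?invr_ge0 ?(ltW r0) ?(ltW R00)// -powRN opprK; congr (_ * _).
    by rewrite -powR_inv1 ?(ltW R00)// -powRrM mulN1r.
  rewrite -(ler_pM2l k0); apply: le_trans H _.
  have -> : r `^ (- (q + b * p)) * (2 * CH * gc * Cd * (r / R0) `^ (q + b * p) * vol d mu x0 R0) =
      2 * CH * gc * R0 `^ (- (q + b * p)) * (Cd * vol d mu x0 R0).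
    by rewrite rR; field; rewrite gt_eqF.
  by apply: ler_wpM2l v2; rewrite !mulr_ge0 ?addr_ge0 ?powR_ge0 ?(ltW CH0).
apply/ler_addgt0Pr => e e0.
(* Coefficient of the cover term after division by rho^(bp); the cover is then chosen with total at
   most e / (c + 1). *)
pose c := 2 * CH * grad_const p beta th n (b * p) * rho `^ (- (b * p)) / rho `^ (b * p).
have c0 : 0 <= c.
  by rewrite /c !mulr_ge0 ?addr_ge0 ?invr_ge0 ?powR_ge0 ?(ltW CH0).
have e'0 : 0 < e / (c + 1) by rewrite divr_gt0// ltr_wpDl.
have q0 : 0 <= q - b * p by rewrite subr_ge0.
have [s [s1 s2 s3 s4 s5]] := content_cover dm dc dB mu_ball dbl oOm x0 q0 H0 R00 rho0 e'0.
have := annulus_estimate dm dc dB mu_ball dbl oOm hardy p1 bp_lt b0 th0 absorb n_large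
  Ex0 R00 rho0 s1 s2 s3 s4 r0.
rewrite -/A -/gc.
have -> : b * p - (p - beta) = - (q - b * p) by rewrite /q; ring.
under eq_bigr do rewrite -mulrA.
rewrite -mulr_sumr.
rewrite (_ : - (b * p) - (p - beta) = - (q + b * p)); last by rewrite /q; ring.
set S := \sum_(B <- s) _ in s5 *.
have -> : rho `^ (b * p) * r `^ (- (b * p)) * r `^ (beta - p) * A =
    rho `^ (b * p) * (r `^ (- (q + b * p)) * A).
  rewrite -[rho `^ _ * _ * _]mulrA -powR_gt0D// mulrA; congr (_ * r `^ _ * _).
  by rewrite /q; ring.
set a := r `^ _ * A; set V := vol _ _ _ _; set T := R0 `^ _.
move=> H; rewrite -(ler_pM2l rb0); apply: le_trans H _.
have -> : 2 * CH * (gc * rho `^ (b * p) * T * V + grad_const p beta th n (b * p) * rho `^ (- (b * p)) * S)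
  = rho `^ (b * p) * (2 * CH * gc * T * V + c * S).
  by rewrite /c; field; rewrite gt_eqF.
apply: ler_wpM2l; first exact: ltW.
rewrite lerD2l; apply: le_trans (ler_wpM2l c0 s5) _.
rewrite mulrA ler_pdivrMr ?ltr_wpDl// mulrC ler_wpM2l ?(ltW e0)//.
by rewrite lerDl.
Qed.

(** The bound on annuli is uniform in rho; rho = 1/(k+1) exhausts the set, and the measure is
    continuous along increasing unions. *)
Lemma punctured_nbhd_bound x0 R0 r : ~ Om x0 -> 0 < R0 -> 0 < r ->
  (mu ([set x | d x0 x <= R0 /\ 0 < dOm d Om x <= r]%R) <=
  (2 * CH * grad_const p beta th n (- (b * p)) * Cd *
  (r / R0) `^ (p - beta + b * p) * vol d mu x0 R0)%:E)%E.
Proof.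
move=> Ex0 R00 r0; set M := (X in X%:E).
pose F (k : nat) := annulus d Om x0 R0 k.+1%:R^-1 r.
have -> : [set x | d x0 x <= R0 /\ 0 < dOm d Om x <= r] = \bigcup_k F k.
  apply/seteqP; split=> [x [xR /andP[x0' xr]]|x [k _ [xR /andP[xk xr]]]].
    have [k] := ltr_add_invr x0'; rewrite add0r => xk.
    by exists k => //; split=> //; rewrite xk xr.
  by split=> //; rewrite xr andbT; apply: lt_trans xk; rewrite invr_gt0 ltr0n.
have mF k : measurable (F k) by exact: (measurable_annulus dm dB _ _ Ex0).
have mono : nondecreasing_seq F.
  move=> k l kl; apply/subsetPset => x [xR /andP[xk xr]]; split=> //.
  rewrite xr andbT; apply: le_lt_trans xk; rewrite lef_pV2 ?posrE ?ltr0n//.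
  by rewrite ler_nat ltnS.
have cv := nondecreasing_cvg_mu (mu := mu) mF (bigcup_measurable (fun k _ => mF k)) mono.
rewrite -(cvg_lim (@ereal_hausdorff R) cv)//; apply: lime_le; first by apply/cvg_ex; eexists; exact: cv.
apply: nearW => k /=.
have fin : mu (F k) \is a fin_num.
  rewrite ge0_fin_numE//; apply: (@le_lt_trans _ _ (mu (cball d x0 R0))).
    by apply: le_measure; rewrite ?inE//; [exact: (measurable_cball dm dB) | move=> x []].
  by rewrite (volE dm dB mu_ball) ltry.
rewrite -(fineK fin) lee_fin; apply: annulus_bound => //.
Qed.

(** The neighbourhood inside a ball splits into its punctured part and points of the complement,
    which is a null set. *)
Lemma lower_assouad_codim_lower_bound : mu (~` Om) = 0%E ->
  ((p - beta + b * p)%:E <= lower_assouad_codim d mu (~` Om))%E.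
Proof.
move=> muE; have bp0 : 0 < b * p by rewrite mulr_gt0// (lt_le_trans _ p1).
apply: ereal_sup_ubound; exists (p - beta + b * p) => //; split.
  by rewrite addr_ge0 ?subr_ge0 ?ltW.
set C := 2 * CH * grad_const p beta th n (- (b * p)) * Cd.
exists (Num.max 1 C); split; first by rewrite le_max lexx.
move=> x r Rr Ex r0 rR _; have R00 := lt_trans r0 rR.
set P := [set y | d x y <= Rr /\ 0 < dOm d Om y <= r].
have mP : measurable P.
  rewrite (_ : P = cball d x Rr `&` (setT `&` dOm d Om @^-1` `]0, r])).
    apply: measurableI; first exact: (measurable_cball dm dB).
    by apply: (measurable_dOm dm dB Ex) => //; exact: measurable_itv.
  by apply/seteqP; split=> y; rewrite /P /cball /= in_itv /=; tauto.
have mE : measurable (~` Om) by apply/measurableC/(measurable_mopen dB).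
apply: (@le_trans _ _ (mu (P `|` ~` Om))).
  apply: le_measure; rewrite ?inE; [|exact: measurableU|].
    by apply: measurableI; [exact: measurable_nbhd_set Ex | exact: (measurable_cball dm dB)].
  move=> y []; rewrite /nbhd_set /cball /= (edistE dm Ex) lte_fin => yr yR.
  have [y0|y0] := ltP 0 (dOm d Om y); first by left; split=> //; rewrite y0 ltW.
  by right => Oy; have := dOm_gt0 dm oOm Ex Oy; rewrite ltNge y0.
apply: (@le_trans _ _ (mu P + mu (~` Om))%E); first exact: measureU2.
rewrite muE adde0.
apply: le_trans (punctured_nbhd_bound Ex R00 r0) _.
rewrite -/C (volE dm dB mu_ball) -EFinM lee_fin; apply: ler_wpM2r.
  by rewrite ltW// (vol_gt0 dm dB mu_ball).
by apply: ler_wpM2r; rewrite ?powR_ge0// le_max lexx orbT.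
Qed.

End Codimension.

(** * Choice of the parameters and degenerate cases *)

Theorem theorem6p1 (R : realType) (p beta Cd CH : R) :
  1 <= p -> beta != p ->
  exists eps : R, 0 < eps /\
  forall (disp : measure_display) (X : measurableType disp)
         (d : X -> X -> R) (mu : {measure set X -> \bar R}) (Om : set X),
    is_metric d -> metric_complete d -> borel_wrt_metric d ->
    balls_pos_finite d mu -> doubling_with d mu Cd ->
    mopen d Om -> hardy_with d mu Om p beta CH ->
    (hausdorff_codim d mu (~` Om) < (p - beta - eps)%:E)%E \/
    ((p - beta + eps)%:E < lower_assouad_codim d mu (~` Om))%E.
Proof.
move=> p1; rewrite neq_lt => /orP[bp|pb]; last first.
  (* For beta > p the threshold p - beta + eps is negative and the second alternative always
     holds. *)
  exists ((beta - p) / 2); split; first by rewrite divr_gt0// subr_gt0.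
  move=> disp X d mu Om dm _ dB _ _ _ _; right.
  apply: lt_le_trans (lower_assouad_codim_ge0 mu Om dm dB).
  by rewrite lte_fin; lra.
have [CH0|CH0] := leP CH 0.
  exists 1; split=> // disp X d mu Om _ _ _ _ _ _ [].
  by rewrite ltNge CH0.
have q0 : 0 < p - beta by rewrite subr_gt0.
have p0 : 0 < p by lra.
(* n is fixed first because [th] depends on it; the later constraint bp <= p - beta lets p - beta
   stand in for bp. *)
pose n := (Num.truncn (`|beta| + (p - beta))).+1.
have nP : `|beta| + (p - beta) <= n%:R by exact/ltW/truncnS_gt.
have n20 : 0 < 2 * n.+1%:R :> R by rewrite mulr_gt0.
have [th /andP[th0 _] thP] := small_powR p1 n20 CH0.
have [b1 /andP[b10 _] b1P] := small_powR p1 (ltr0n R 2) CH0.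
pose b := Num.min b1 ((p - beta) / p).
have b0 : 0 < b by rewrite lt_min b10 divr_gt0.
have b_le : b * p <= p - beta by rewrite -ler_pdivlMr// ge_min lexx orbT.
have bp0 : 0 < b * p by rewrite mulr_gt0.
have absorb : ((2 * n.+1%:R * th) `^ p + (2 * b) `^ p) * CH <= 2^-1.
  have : (2 * b) `^ p * CH <= (2 * b1) `^ p * CH.
    apply: ler_wpM2r; first exact: ltW.
    apply: ge0_le_powR; [exact: ltW | by rewrite mulr_ge0// ltW |].
    by rewrite ler_wpM2l// ge_min lexx.
  by rewrite mulrDl; move: thP b1P; lra.
have n_large : `|beta| + b * p <= n%:R * p.
  have : n%:R * 1 <= n%:R * p by rewrite ler_wpM2l.
  by rewrite mulr1; move: nP b_le; lra.
exists (b * p / 2); split; first by rewrite divr_gt0.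
move=> disp X d mu Om dm dc dB mu_ball dbl oOm hardy.
have [E0|/set0P[x Ex]] := eqVneq (~` Om) set0.
  by right; rewrite lower_assouad_codim_empty// ltry.
have [muE|muE] := ltP 0%E (mu (~` Om)).
  left; rewrite /hausdorff_codim asboolT// lte_fin.
  by move: b_le bp0; lra.
have {}muE : mu (~` Om) = 0%E by apply/eqP; rewrite eq_le muE measure_ge0.
have [|H] := ltP (hausdorff_codim d mu (~` Om)) (p - beta - b * p / 2)%:E.
  by left.
right; apply: (@lt_le_trans _ _ (p - beta + b * p)%:E).
  by rewrite lte_fin; move: bp0; lra.
have {H} : ((p - beta - b * p)%:E < hausdorff_codim d mu (~` Om))%E.
  by apply: lt_le_trans H; rewrite lte_fin; move: bp0; lra.
(* A codimension of at least q - bp/2 exceeds q - bp, so the content vanishes for some q' above q -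
   bp, and by monotonicity at q - bp itself. *)
rewrite /hausdorff_codim asboolF ?muE ?ltxx// => /ereal_sup_gt[_ [q' [q'0 Hq'] <-]].
rewrite lte_fin => /ltW qq'.
have content0 : hcontent d mu (p - beta - b * p) 1 (~` Om) = 0%E.
  apply/eqP; rewrite eq_le hcontent_ge0 andbT -Hq'.
  exact: hcontent_le.
exact: (lower_assouad_codim_lower_bound dm dc dB mu_ball dbl oOm hardy p1 bp b0 th0
  absorb n_large b_le content0 muE).
Qed.
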